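(* Let $(\mathcal R,\Lambda,S)$ be a generalized Renner-Coxeter system with $\mathcal R$ finite, let $w_0$ be the longest element of its group of units $W$, put $\Lambda^{+}=\Lambda$ and $\Lambda^{-}=w_0\Lambda w_0$, and let $\varepsilon\in\{+,-\}$. Let $r=\sigma_-e_-\sigma_0e_+\sigma_+$ be written in vanilla form in $(\mathcal R,\Lambda^{\varepsilon},S)$. Then: (1) $r=\min^{\varepsilon}H_r$ if and only if $\sigma_0={}^{\lambda(e_-)}w_0{}^{\lambda(e_+)}$. (2) $r=\min^{\varepsilon}L_r$ if and only if $\sigma_-={}^{\lambda(e_+)}w_0{}^{\lambda(e_-)}$ and $\sigma_0={}^{\lambda(e_-)}w_0{}^{\lambda(e_+)}$. (3) $r=\min^{\varepsilon}R_r$ if and only if $\sigma_0={}^{\lambda(e_-)}w_0{}^{\lambda(e_+)}$ and $\sigma_+={}^{\lambda(e_+)}w_0{}^{\lambda(e_-)}$. (4) $r=\min^{\varepsilon}J_r$ if and only if $\sigma_-={}^{\lambda(e_+)}w_0{}^{\lambda(e_-)}$, $\sigma_0={}^{\lambda(e_-)}w_0{}^{\lambda(e_+)}$ and $\sigma_+={}^{\lambda(e_+)}w_0{}^{\lambda(e_-)}$. (5) $r=\max^{\varepsilon}H_r$ if and only if $\sigma_0={}^{\lambda_*(e_-)}w_0{}^{\lambda_*(e_+)}$. (6) $r=\max^{\varepsilon}L_r$ if and only if $\sigma_-=1$ and $\sigma_0={}^{\lambda_*(e_-)}w_0{}^{\lambda_*(e_+)}$. (7) $r=\max^{\varepsilon}R_r$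 if and only if $\sigma_0={}^{\lambda_*(e_-)}w_0{}^{\lambda_*(e_+)}$ and $\sigma_+=1$. (8) $r=\max^{\varepsilon}J_r$ if and only if $\sigma_-=1$, $\sigma_0={}^{\lambda_*(e_-)}w_0{}^{\lambda_*(e_+)}$ and $\sigma_+=1$.
   Context: For a Coxeter system $(W,S)$, $\leq$ is the Bruhat order. For $I,J\subseteq S$, $W_I$ is the subgroup generated by $I$; $W^I$ (resp. ${}^IW$) is the set of $w\in W$ that are the Bruhat-minimum of $wW_I$ (resp. $W_Iw$); ${}^Iw^J$ is the Bruhat-minimum element of the double coset $W_IwW_J$. A generalized Renner-Coxeter system is a triple $(\mathcal R,\Lambda,S)$ such that: (i) $\mathcal R$ is a factorizable monoid with group of units $W$, i.e. $\mathcal R=E(\mathcal R)W=WE(\mathcal R)$, where the set $E(\mathcal R)$ of idempotents is a meet semilattice under $e\leq f\Leftrightarrow ef=fe=e$ (meet = product; thus $\mathcal R$ is an inverse monoid); (ii) $\Lambda$ is a transversal of $E(\mathcal R)$ for the conjugation action of $W$ and a sub-meet semilattice; (iii) $(W,S)$ is a Coxeter system; (iv) for every $e\leq e'$ in $E(\mathcal R)$ there are $w\in W$ and $f\leq f'$ in $\Lambda$ with $wew^{-1}=f$, $we'w^{-1}=f'$; (v) the map $\lambda^*(e)=\{s\in S\mid se=es\neq e\}$ on $\Lambda$ satisfies $e\leq f\Rightarrow\lambda^*(e)\subseteq\lambda^*(f)$; (vi) for every $e\in\Lambda$, $\{w\in W\mid we=ew\}$ and $\{w\in W\mid we=ew=e\}$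 are standard parabolic subgroups of $W$. The subsets $\lambda(e),\lambda_*(e)\subseteq S$ are defined by $W_{\lambda(e)}=\{w\in W\mid we=ew\}$ and $W_{\lambda_*(e)}=\{w\in W\mid we=ew=e\}$. If $\mathcal R$ is finite, $(\mathcal R,\Lambda^-,S)$ with $\Lambda^-=w_0\Lambda w_0$ is again a generalized Renner-Coxeter system (so $\lambda,\lambda_*,\lambda^*$ are also defined on $\Lambda^-$ by the same formulas), and $w_0\Lambda^-w_0=\Lambda$. Each $r\in\mathcal R$ has a unique left standard form $r=xey$ ($e\in\Lambda$, $x\in W^{\lambda_*(e)}$, $y\in{}^{\lambda(e)}W$) and a unique right standard form $r=yex$ ($e\in\Lambda$, $y\in W^{\lambda(e)}$, $x\in{}^{\lambda_*(e)}W$). Adherence orders in $(\mathcal R,\Lambda,S)$: if $r=xey$, $s=afb$ are in left standard form, $r\leq^{+}s$ iff $e\leq f$ and there is $w\in W_{\lambda^*(f)}W_{\lambda_*(e)}$ with $x\leq aw$ and $w^{-1}b\leq y$. If $r=yex$, $s=bfa$ are in right standard form, $r\leq^{-}s$ iff $e\leq f$ and there is $w\in W_{\lambda_*(e)}W_{\lambda^*(f)}$ with $x\leq wa$ and $bw^{-1}\leq y$. Vanilla form in $(\mathcal R,\Lambda,S)$: the unique decomposition $r=\sigma_-e_-\sigma_0e_+\sigma_+$ with $e_+\in\Lambda$, $e_-\in w_0\Lambda w_0$, $e_-\mathscr Jr\mathscr Je_+$, $\sigma_+\in{}^{\lambda(e_+)}W$, $\sigma_-\in W^{\lambda(e_-)}$,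 $\sigma_0\in W_{\lambda^*(e_-)}\big({}^{\lambda_*(e_-)}w_0{}^{\lambda_*(e_+)}\big)W_{\lambda^*(e_+)}$. The vanilla form in $(\mathcal R,\Lambda^-,S)$ is the same with $\Lambda$ replaced by $\Lambda^-$ (so $e_+\in\Lambda^-$, $e_-\in\Lambda$). Green's relations: $r\mathscr Js$ iff $\mathcal Rr\mathcal R=\mathcal Rs\mathcal R$ (iff $WrW=WsW$); $r\mathscr Ls$ iff $\mathcal Rr=\mathcal Rs$ (iff $Wr=Ws$); $r\mathscr Rs$ iff $r\mathcal R=s\mathcal R$ (iff $rW=sW$); $\mathscr H=\mathscr L\cap\mathscr R$. $J_r,L_r,R_r,H_r$ are the classes of $r$. For a class $T_r$, $\max^{\varepsilon}T_r$ (resp. $\min^{\varepsilon}T_r$) is the element $s\in T_r$ with $t\leq^{\varepsilon}s$ (resp. $s\leq^{\varepsilon}t$) for all $t\in T_r$, if it exists, where $\leq^{\varepsilon}$ is the Adherence order of $(\mathcal R,\Lambda,S)$. *)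

(* Defs.v *)
From HB Require Import structures.
From mathcomp Require Import all_boot all_fingroup.

Set Implicit Arguments.
Unset Strict Implicit.
Unset Printing Implicit Defensive.

Local Open Scope group_scope.

(* The library has no join of [monoidType] and [finType]: an HB structure for it
   would have to be declared before [finStarMonoidType]. *)
Record finMonoidType := FinMonoidType {
  fm_monoid : monoidType;
  fm_enum : seq fm_monoid;
  fm_enumP : Finite.axiom fm_enum
}.

Definition fm_sort (R : finMonoidType) : Type := fm_monoid R.
Coercion fm_sort : finMonoidType >-> Sortclass.

HB.instance Definition _ (R : finMonoidType) :=
  Monoid.copy (fm_sort R) (fm_monoid R).

Lemma fm_pickleK (R : finMonoidType) :
  pcancel (fun x : R => index x (fm_enum R)) (onth (fm_enum R)).
Proof.
move=> x; have x_in : x \in fm_enum R by rewrite -has_pred1 has_count fm_enumP.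
by rewrite onthE (nth_map x) ?index_mem // nth_index.
Qed.

HB.instance Definition _ (R : finMonoidType) :=
  isCountable.Build (fm_sort R) (@fm_pickleK R).
HB.instance Definition _ (R : finMonoidType) :=
  isFinite.Build (fm_sort R) (@fm_enumP R).

Definition is_munit (R : finMonoidType) (u : R) : bool :=
  [exists v : R, (u * v == 1) && (v * u == 1)].

Inductive munits (R : finMonoidType) := MUnit (u : R) of is_munit u.

Section Units.
Variable R : finMonoidType.

Definition muval (u : munits R) : R := let: MUnit x _ := u in x.

HB.instance Definition _ := [isSub for muval].
HB.instance Definition _ := [Finite of munits R by <:].

Lemma munit1 : is_munit (1 : R).
Proof. by apply/existsP; exists 1; rewrite mulg1 eqxx. Qed.

Lemma munitM (u v : munits R) : is_munit (muval u * muval v).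
Proof.
case: u v => [x ux] [y uy] /=; move: ux uy.
case/existsP=> x' /andP[/eqP xx' /eqP x'x].
case/existsP=> y' /andP[/eqP yy' /eqP y'y].
apply/existsP; exists (y' * x').
by rewrite -mulgA (mulgA y) yy' mul1g xx' -mulgA (mulgA x') x'x mul1g y'y eqxx.
Qed.

Definition munit_inv_val (u : munits R) : R :=
  odflt 1 [pick v : R | (muval u * v == 1) && (v * muval u == 1)].

Lemma munit_inv_valP (u : munits R) :
  (muval u * munit_inv_val u = 1) * (munit_inv_val u * muval u = 1).
Proof.
rewrite /munit_inv_val; case: pickP => [v /andP[/eqP ? /eqP ?] //|no].
by case: u no => x /= ux; case/existsP: (ux) => v Hv /(_ v); rewrite Hv.
Qed.

Lemma munitV (u : munits R) : is_munit (munit_inv_val u).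
Proof. by apply/existsP; exists (muval u); rewrite !munit_inv_valP eqxx. Qed.

Definition munit_mul (u v : munits R) : munits R := MUnit (munitM u v).
Definition munit_one : munits R := MUnit munit1.
Definition munit_inv (u : munits R) : munits R := MUnit (munitV u).

Lemma munit_mulA : associative munit_mul.
Proof. by move=> u v w; apply: val_inj; rewrite /= mulgA. Qed.

Lemma munit_mul1 : left_id munit_one munit_mul.
Proof. by move=> u; apply: val_inj; rewrite /= mul1g. Qed.

Lemma munit_mulV : left_inverse munit_one munit_inv munit_mul.
Proof. by move=> u; apply: val_inj; rewrite /= munit_inv_valP. Qed.

HB.instance Definition _ :=
  Finite_isGroup.Build (munits R) munit_mulA munit_mul1 munit_mulV.

End Units.

Coercion muval : munits >-> fm_sort.

(* [W] is presented by the generators [S] and the relations [(st)^m = 1] with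
   [m] the order of [st]; the presentation is expressed by its universal
   property. *)
Record coxeter_system (W : finGroupType) (S : {set W}) : Prop := CoxeterSystem {
  cox_gen : <<S>> = [set: W];
  cox_order2 : forall s, s \in S -> #[s] = 2;
  cox_universal : forall (G : groupType) (f : W -> G),
    (forall s t, s \in S -> t \in S -> (f s * f t) ^+ #[s * t] = 1) ->
    exists2 phi : W -> G,
      {morph phi : x y / x * y} & {in S, forall s, phi s = f s}
}.

Section Coxeter.
Variables (W : finGroupType) (S : {set W}).
Implicit Types (u v w : W) (I J : {set W}).

(* [S ^+ k] is the set of products of [k] elements of [S].  Searching
   [k < #|W|] is enough when [S] generates [W]: the prefixes of a shortest word
   have pairwise distinct products. *)
Definition cox_len w : nat := find (fun k => w \in S ^+ k) (iota 0 #|W|).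

Definition reflections : {set W} := class_support S [set: W].

Definition bruhat_step : rel W := fun u v =>
  [exists t in reflections, v == u * t] && (cox_len u < cox_len v)%N.

Definition bruhat : rel W := connect bruhat_step.

Definition longest : W := [arg max_(w > 1) cox_len w].

Definition bruhat_min (A : {set W}) w : bool :=
  (w \in A) && [forall v in A, bruhat w v].

(* [min_lcosets I] is W^I and [min_rcosets I] is ^IW. *)
Definition min_lcosets I : {set W} := [set w | bruhat_min (w *: <<I>>) w].
Definition min_rcosets I : {set W} := [set w | bruhat_min (<<I>> :* w) w].

(* ^I w ^J; the default value is never used in a Coxeter system. *)
Definition min_dcoset I w J : W :=
  odflt w [pick v | bruhat_min (<<I>> * [set w] * <<J>>) v].

Definition std_parabolic (H : {set W}) : Prop :=
  exists2 I : {set W}, I \subset S & <<I>> = H.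

(* The set [I] included in [S] with [<<I>> = H], unique in a Coxeter system. *)
Definition parabolic_type (H : {set W}) : {set W} :=
  odflt set0 [pick I : {set W} | (I \subset S) && (<<I>> == H)].

End Coxeter.

Section Renner.
Variable R : finMonoidType.
Local Notation W := (munits R).
Implicit Types (r s t e f g : R) (Lam A : {set R}) (S : {set W}).

Definition idempotents : {set R} := [set e : R | e * e == e].

Definition idem_le : rel R := fun e f => (e * f == e) && (f * e == e).

Definition is_meet A e f m : Prop :=
  [/\ m \in A, idem_le m e, idem_le m f
    & forall g, g \in A -> idem_le g e -> idem_le g f -> idem_le g m].

Definition fixW e : {set W} := [set w : W | (w : R) * e == e * (w : R)].
Definition stabW e : {set W} :=
  [set w : W | ((w : R) * e == e * (w : R)) && (e * (w : R) == e)].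

(* [lam], [lam_low] and [lam_up] are lambda, lambda_* and lambda^*. *)
Definition lam S e : {set W} := parabolic_type S (fixW e).
Definition lam_low S e : {set W} := parabolic_type S (stabW e).
Definition lam_up S e : {set W} :=
  [set s in S | ((s : R) * e == e * (s : R)) && (e * (s : R) != e)].

Record renner_coxeter Lam S : Prop := RennerCoxeter {
  rc_factor : forall r,
    (exists e (w : W), e \in idempotents /\ r = e * (w : R)) /\
    (exists (w : W) e, e \in idempotents /\ r = (w : R) * e);
  rc_meet : forall e f, e \in idempotents -> f \in idempotents ->
    is_meet idempotents e f (e * f);
  rc_sub : Lam \subset idempotents;
  rc_transversal : forall e, e \in idempotents ->
    exists! f, f \in Lam /\
      exists w : W, (w : R) * e * ((w^-1 : W) : R) = f;
  rc_submeet : forall e f, e \in Lam -> f \in Lam -> e * f \in Lam;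
  rc_coxeter : coxeter_system S;
  rc_chain : forall e e', e \in idempotents -> e' \in idempotents ->
    idem_le e e' ->
    exists (w : W) f f', [/\ f \in Lam, f' \in Lam & idem_le f f'] /\
      [/\ (w : R) * e * ((w^-1 : W) : R) = f
        & (w : R) * e' * ((w^-1 : W) : R) = f'];
  rc_lam_up : forall e f, e \in Lam -> f \in Lam -> idem_le e f ->
    lam_up S e \subset lam_up S f;
  rc_parabolic : forall e, e \in Lam ->
    std_parabolic S (fixW e) /\ std_parabolic S (stabW e)
}.

Definition conj_longest S Lam : {set R} :=
  [set (longest S : R) * e * (longest S : R) | e : R in Lam].

Definition greenJ r s : bool :=
  [set a * r * b | a : R, b : R] ==
  [set a * s * b | a : R, b : R].
Definition greenL r s : bool :=
  [set a * r | a : R] == [set a * s | a : R].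
Definition greenR r s : bool :=
  [set r * a | a : R] == [set s * a | a : R].
Definition greenH r s : bool := greenL r s && greenR r s.

Definition J_class r : {set R} := [set s | greenJ s r].
Definition L_class r : {set R} := [set s | greenL s r].
Definition R_class r : {set R} := [set s | greenR s r].
Definition H_class r : {set R} := [set s | greenH s r].

Definition left_std Lam S r (x : W) e (y : W) : Prop :=
  [/\ e \in Lam, x \in min_lcosets S (lam_low S e),
      y \in min_rcosets S (lam S e) & r = (x : R) * e * (y : R)].

Definition right_std Lam S r (y : W) e (x : W) : Prop :=
  [/\ e \in Lam, y \in min_lcosets S (lam S e),
      x \in min_rcosets S (lam_low S e) & r = (y : R) * e * (x : R)].

Definition adh_plus Lam S r s : Prop :=
  exists (x : W) e (y : W) (a : W) f (b : W),
  [/\ left_std Lam S r x e y, left_std Lam S s a f b, idem_le e f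
    & exists w : W, [/\ w \in <<lam_up S f>> * <<lam_low S e>>,
                        bruhat S x (a * w) & bruhat S (w^-1 * b) y]].

Definition adh_minus Lam S r s : Prop :=
  exists (y : W) e (x : W) (b : W) f (a : W),
  [/\ right_std Lam S r y e x, right_std Lam S s b f a, idem_le e f
    & exists w : W, [/\ w \in <<lam_low S e>> * <<lam_up S f>>,
                        bruhat S x (w * a) & bruhat S (b * w^-1) y]].

(* In the sign arguments, [true] stands for + and [false] for -. *)

Definition adherence (eps : bool) Lam S : R -> R -> Prop :=
  if eps then adh_plus Lam S else adh_minus Lam S.

Definition Lam_sign (eps : bool) Lam S : {set R} :=
  if eps then Lam else conj_longest S Lam.

Definition is_min (le : R -> R -> Prop) A r : Prop :=
  r \in A /\ forall t, t \in A -> le r t.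
Definition is_max (le : R -> R -> Prop) A r : Prop :=
  r \in A /\ forall t, t \in A -> le t r.

Definition vanilla Lam S r (sm : W) em (s0 : W) ep (sp : W) : Prop :=
  [/\ [/\ ep \in Lam, em \in conj_longest S Lam, greenJ em r & greenJ r ep],
      sp \in min_rcosets S (lam S ep), sm \in min_lcosets S (lam S em),
      s0 \in <<lam_up S em>>
             * [set min_dcoset S (lam_low S em) (longest S) (lam_low S ep)]
             * <<lam_up S ep>>
    & r = (sm : R) * em * (s0 : R) * ep * (sp : R)].

End Renner.

(* Main.v *)
(* Fix [e] in [Lam] and let [J], [A], [B] be [lambda(e)], [lambda_*(e)] and
   [lambda^*(e)], so that [W_J] is the direct product of [W_B] and [W_A].  In the
   vanilla form of an element of [WeW] one has [e_- = w0 e w0], and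
   [sigma_0 = w0 z w_A] for a unique [z] in [W_B]; the left standard form is then
   [x e sigma_+] with [x = sigma_- w0 z w_A].  Here [sigma_- w0] is the longest
   element of its coset [sigma_- w0 W_J], so [x] runs over the minimal coset
   representatives modulo [W_A] lying in [sigma_- w0 W_J], between
   [sigma_- w0 w_J] (for [z = w_J w_A]) and [sigma_- w0 w_A] (for [z = 1]).
   Within a J-class the Adherence order is implied by comparing the left factors
   and, in reverse, the right ones, and it is antisymmetric, so that each extremum
   is obtained by making every free coordinate extremal.  The order [<=^-] is
   carried to [<=^+] by the anti-automorphism [r |-> r^-1] of the inverse monoid,
   which exchanges the L- and R-classes and reverses vanilla forms. *)

Require Import Defs.
From mathcomp Require Import all_boot all_fingroup.
From mathcomp Require Import zify.

Set Implicit Arguments.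
Unset Strict Implicit.
Unset Printing Implicit Defensive.

Local Open Scope group_scope.

(** * Words and length in a Coxeter group *)

(** The Coxeter theory is derived from the universal property of the presentation: it yields an
    action on signed reflections, hence strong exchange and the rule for the inversion set of a
    product. With shortest and longest coset representatives expressed by additivity and
    subtractivity of length, coset arguments become linear arithmetic, and Bruhat comparisons are
    built from explicit reflections whose effect on length is known. That [W_J] is the direct
    product of [W_B] and [W_A] is a theorem, not an axiom: [W_A] is normal in [W_J] as a stabilizer,
    and a length count upgrades normality to commutation. On the monoid side the key is finiteness:
    a unit [u] with [e <= u e u^-1] must fix [e]. This makes J-equivalent members of [Lam] equal,
    and lets the cosets in a standard form be read off from one-sided relations. *)

Lemma mem_expg_word (W : finGroupType) (A : {set W}) k w :
  reflect (exists ws, [/\ all [in A] ws, size ws = k & \prod_(s <- ws) s = w])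
          (w \in A ^+ k).
Proof.
elim: k w => [|k IHk] w.
  rewrite expg0; apply: (iffP set1P) => [->|[ws [_ /size0nil -> <-]]].
    by exists [::]; rewrite big_nil.
  by rewrite big_nil.
rewrite expgS; apply: (iffP mulsgP) => [[s v Ss /IHk[ws [wsS <- <-]] ->]|].
  by exists (s :: ws); rewrite /= Ss wsS big_cons.
case=> [[|s ws] [//= /andP[Ss wsS] [szws] <-]].
rewrite big_cons; exists s (\prod_(t <- ws) t) => //.
by apply/IHk; exists ws.
Qed.

Lemma mem_gen_word (W : finGroupType) (A : {set W}) w :
  w \in <<A>> -> exists2 ws, all [in A] ws & \prod_(s <- ws) s = w.
Proof.
case/gen_prodgP=> n [c cA ->]; exists [seq c i | i <- enum 'I_n].
  by apply/allP=> _ /mapP[i _ ->]; apply: cA.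
by rewrite big_map [index_enum _]unlock enumT.
Qed.

Lemma word_mem_gen (W : finGroupType) (A : {set W}) ws :
  all [in A] ws -> \prod_(s <- ws) s \in <<A>>.
Proof.
move/allP=> wsA; rewrite big_seq.
by apply: group_prod => s /wsA As; apply: mem_gen.
Qed.

Section Length.
Variables (W : finGroupType) (S : {set W}).
Hypothesis HS : coxeter_system S.
Local Notation len := (cox_len S).
Implicit Types (u v w t s : W) (ws : seq W).

Lemma cox_mem_gen w : w \in <<S>>.
Proof. by rewrite (cox_gen HS) inE. Qed.

Lemma cox_sqr s : s \in S -> s * s = 1.
Proof. by move=> Ss; rewrite -expg2 -(cox_order2 HS Ss) expg_order. Qed.

Lemma cox_inv s : s \in S -> s^-1 = s.
Proof. by move=> Ss; apply: (mulgI s); rewrite cox_sqr // mulgV. Qed.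

Lemma cox_mulKg s : s \in S -> cancel (mulg s) (mulg s).
Proof. by move=> Ss w; rewrite mulgA cox_sqr // mul1g. Qed.

Lemma cox_neq1 s : s \in S -> s != 1.
Proof. by move=> Ss; rewrite -order_eq1 (cox_order2 HS Ss). Qed.

(* The prefixes of a shortest word have distinct products, so the search in
   [cox_len] succeeds. *)
Lemma short_word w : exists2 k, (k < #|W|)%N & w \in S ^+ k.
Proof.
have ex_k : exists k, w \in S ^+ k.
  have [ws wsS def_w] := mem_gen_word (cox_mem_gen w).
  by exists (size ws); apply/mem_expg_word; exists ws.
case: (ex_minnP ex_k) => k /[dup] wSk /mem_expg_word[ws [wsS sz_ws def_w]] min_k.
exists k => //; pose p (i : 'I_k.+1) := \prod_(s <- take i ws) s.
suffices inj_p : injective p by rewrite -(card_ord k.+1); apply: leq_card inj_p.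
have p_lt i j : p i = p j -> ~~ (i < j)%N.
  move=> eq_p; apply/negP=> lt_ij.
  have: w \in S ^+ (i + (k - j)).
    apply/mem_expg_word; exists (take i ws ++ drop j ws); split.
    - rewrite all_cat; apply/andP; split; apply/allP=> s.
        by move/mem_take; apply: (allP wsS).
      by move/mem_drop; apply: (allP wsS).
    - by rewrite size_cat size_drop size_takel sz_ws // -ltnS.
    - by rewrite big_cat /= -/(p i) eq_p -big_cat cat_take_drop.
  move/min_k; have := ltn_ord j; move: lt_ij; move: (nat_of_ord i) (nat_of_ord j).
  by move=> a b; lia.
move=> i j eq_p; apply/val_inj/eqP; rewrite eqn_leq.
by rewrite leqNgt p_lt //= leqNgt p_lt.
Qed.

Lemma reduced_word w :
  exists ws, [/\ all [in S] ws, size ws = len w & \prod_(s <- ws) s = w].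
Proof.
apply/mem_expg_word; have [k lt_k wSk] := short_word w.
have has_k : has (fun j => w \in S ^+ j) (iota 0 #|W|).
  by apply/hasP; exists k; rewrite // mem_iota.
have := nth_find 0 has_k; rewrite has_find size_iota in has_k.
by rewrite nth_iota.
Qed.

Lemma len_word ws : all [in S] ws -> (len (\prod_(s <- ws) s) <= size ws)%N.
Proof.
move=> wsS; rewrite leqNgt; apply/negP=> lt_ws.
have:= before_find 0 lt_ws.
set w := \prod_(s <- ws) s in lt_ws *.
have lt_W : (len w < #|W|)%N.
  have [k lt_k wSk] := short_word w.
  have : has (fun j => w \in S ^+ j) (iota 0 #|W|).
    by apply/hasP; exists k; rewrite // mem_iota.
  by rewrite has_find size_iota.
rewrite nth_iota ?(ltn_trans lt_ws) // add0n; case/mem_expg_word.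
by exists ws.
Qed.

Lemma len1 : len 1 = 0.
Proof. by apply/eqP; have := @len_word [::] isT; rewrite big_nil leqn0. Qed.

Lemma len_eq0 w : (len w == 0) = (w == 1).
Proof.
apply/eqP/eqP=> [|->]; last exact: len1.
by have [ws [_ <- <-]] := reduced_word w; move/size0nil->; rewrite big_nil.
Qed.

Lemma lenM u v : (len (u * v) <= len u + len v)%N.
Proof.
have [us [usS <- <-]] := reduced_word u; have [vs [vsS <- <-]] := reduced_word v.
by rewrite -big_cat -size_cat len_word // all_cat usS.
Qed.

Lemma lenV w : len w^-1 = len w.
Proof.
suffices le_lenV u : (len u^-1 <= len u)%N.
  by apply/eqP; rewrite eqn_leq le_lenV -{1}[w]invgK le_lenV.
have [us [usS <- <-]] := reduced_word u; rewrite -size_rev.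
have -> : (\prod_(s <- us) s)^-1 = \prod_(s <- rev us) s.
  elim: us usS => [|s us IHus] /=; first by rewrite !big_nil invg1.
  case/andP=> Ss usS; rewrite rev_cons -cats1 big_cat big_seq1 big_cons.
  by rewrite invgM IHus ?cox_inv.
by rewrite len_word // all_rev.
Qed.

Lemma len_gen s : s \in S -> len s = 1%N.
Proof.
move=> Ss; apply/eqP; rewrite eqn_leq lt0n len_eq0 cox_neq1 // andbT.
by have := @len_word [:: s]; rewrite /= Ss big_seq1; apply.
Qed.

Lemma len_eq1 w : len w = 1%N -> w \in S.
Proof.
have [[|s [|? ?]] [/= wS <- <-]] := reduced_word w => //.
by rewrite big_seq1; rewrite andbT in wS.
Qed.

Lemma len_genM s w : s \in S -> (len (s * w) <= (len w).+1)%N.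
Proof. by move=> Ss; rewrite (leq_trans (lenM _ _)) // len_gen. Qed.

Lemma len_genM_ge s w : s \in S -> (len w <= (len (s * w)).+1)%N.
Proof. by move=> Ss; rewrite -{1}[w](cox_mulKg Ss) len_genM. Qed.

Lemma len_genMV s w : s \in S -> len (s * w^-1) = len (w * s).
Proof. by move=> Ss; rewrite -lenV invgM invgK cox_inv. Qed.

End Length.
(** * Inversions and the exchange property *)

Section Inversions.
Variables (W : finGroupType) (S : {set W}).
Hypothesis HS : coxeter_system S.
Local Notation len := (cox_len S).
Local Notation refl := (reflections S).
Implicit Types (u v w t s : W) (ws : seq W).

(** The classical action on signed reflections: conjugate, and flip the sign when the reflection is
    the acting generator. It lives on all of [W * bool] rather than on a subtype of reflections;
    only its values at generators are extended to a morphism. *)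
Definition reflection_act w (p : W * bool) := (p.1 ^ w, p.2 (+) (p.1 == w)).

Lemma reflection_act_inj w : injective (reflection_act w).
Proof.
by move=> [t b] [t' b'] [/conjg_inj-> /(can_inj (addbK _))->].
Qed.

Definition reflection_perm w : {perm W * bool} := perm (@reflection_act_inj w).

(** The sign flips once for each occurrence of [t] among the elements [(s * s') ^+ j * s]; every
    factor [s * s'] contributes two consecutive values of [j]. *)
Lemma reflection_permMX s s' n t b : s \in S -> s' \in S ->
  ((reflection_perm s * reflection_perm s') ^+ n) (t, b)
  = (t ^ ((s * s') ^+ n),
     b (+) \big[addb/false]_(0 <= j < n.*2) (t == (s * s') ^+ j * s)).
Proof.
move=> Ss Ss'; set a := s * s'.
have aJ m : s * a ^- m = a ^+ m * s.
  rewrite -expVgn /a invgM !(cox_inv HS) //.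
  elim: m => [|m IHm]; first by rewrite !expg0 mulg1 mul1g.
  by rewrite !expgS -[RHS]mulgA -IHm !mulgA.
have conj_eq g u : (t ^ g == u) = (t == u ^ g^-1).
  by apply/eqP/eqP=> [<-|->]; rewrite ?conjgK ?conjgKV.
elim: n => [|n IHn]; first by rewrite !expg0 perm1 conjg1 big_geq // addbF.
rewrite expgSr permM IHn permM !permE /reflection_act /= -!conjgM doubleS.
rewrite !big_nat_recr //= -!addbA; congr (_, _ (+) (_ (+) (_ (+) _))).
- by rewrite expgSr.
- by rewrite conj_eq conjgE invgK aJ mulgA -expgD addnn.
- rewrite conj_eq conjgE invgK invgM (cox_inv HS) // -!mulgA aJ !mulgA.
  by rewrite -(mulgA _ s s') -/a -expgSr -expgD addSn addnn.
Qed.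

(** The list of elements [(s * s') ^+ j * s] for [j < 2m] runs twice through a period of length [m],
    so the sign flips cancel in pairs. *)
Lemma reflection_perm_rel s s' : s \in S -> s' \in S ->
  (reflection_perm s * reflection_perm s') ^+ #[s * s'] = 1.
Proof.
move=> Ss Ss'; apply/permP=> [[t b]]; rewrite perm1 reflection_permMX //.
set m := #[s * s']; rewrite expg_order conjg1; congr (_, _).
rewrite -addnn (big_cat_nat (leq0n m)) ?leq_addr //=.
rewrite (_ : \big[_/_]_(m <= j < _) _ = \big[addb/false]_(0 <= j < m)
    (t == (s * s') ^+ (j + m) * s)); last by rewrite -{1}[m]add0n big_addn addnK.
under [X in _ (+) (_ (+) X)]eq_bigr => j _ do rewrite expgD expg_order mulg1.
by rewrite addbb addbF.
Qed.

(* [eta w t] is the parity of the number of occurrences of the reflection [t]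
   among the conjugates [s_1 ... s_(i-1) s_i s_(i-1) ... s_1] attached to any
   word [s_1 ... s_k] with product [w]. *)
Lemma reflection_cocycle : exists eta : W -> W -> bool,
  (forall u v t, eta (u * v) t = eta u t (+) eta v (t ^ u)) /\
  (forall s t, s \in S -> eta s t = (t == s)).
Proof.
have [phi phiM phiS] := cox_universal HS reflection_perm_rel.
have phi1 : phi 1 = 1 by apply: (mulgI (phi 1)); rewrite -phiM !mulg1.
have phiE w t b : phi w (t, b) = (t ^ w, b (+) (phi w (t, false)).2).
  have [ws wsS <-] := mem_gen_word (cox_mem_gen HS w).
  elim: ws wsS t b => [_|s ws IHws /= /andP[Ss wsS]] t b.
    by rewrite big_nil phi1 !perm1 conjg1 addbF.
  rewrite big_cons phiM !permM (phiS s) // !permE /reflection_act /=.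
  by rewrite IHws // [in RHS]IHws //= conjgM addbA.
exists (fun w t => (phi w (t, false)).2); split=> [u v t|s t Ss].
  by rewrite phiM permM phiE [in LHS]phiE.
by rewrite phiS // permE.
Qed.

Lemma mem_reflections s u : s \in S -> s ^ u \in refl.
Proof. by move=> Ss; apply: imset2_f. Qed.

Lemma gen_reflections s : s \in S -> s \in refl.
Proof. by rewrite -{2}[s]conjg1; apply: mem_reflections. Qed.

Lemma reflectionsJ t u : t \in refl -> t ^ u \in refl.
Proof.
by case/imset2P=> s v Ss _ ->; rewrite -conjgM; apply: mem_reflections.
Qed.

Lemma reflection_sqr t : t \in refl -> t * t = 1.
Proof.
by case/imset2P=> s v Ss _ ->; rewrite -conjMg (cox_sqr HS) // conj1g.
Qed.

Lemma reflection_inv t : t \in refl -> t^-1 = t.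
Proof. by move=> /reflection_sqr tt; apply: (mulgI t); rewrite mulgV. Qed.

Lemma reflection_mulKg t : t \in refl -> cancel (mulg t) (mulg t).
Proof. by move=> /reflection_sqr tt w; rewrite mulgA tt mul1g. Qed.

(** An odd parity forces an occurrence of [t], and multiplying by [t] deletes the corresponding
    letter; on a reduced word this shortens. Conversely, [t] has odd parity on itself, so if it has
    even parity on [w] it has odd parity on [t * w], and then [w] is shorter than [t * w]. *)
Lemma exchange_cocycle : exists eta : W -> W -> bool,
  [/\ forall u v t, eta (u * v) t = eta u t (+) eta v (t ^ u),
      forall w t, t \in refl -> eta w t = (len (t * w) < len w)%N &
      forall ws t, all [in S] ws -> eta (\prod_(s <- ws) s) t ->
        exists ws1 s ws2, ws = ws1 ++ s :: ws2
          /\ t * \prod_(s <- ws) s = \prod_(s <- ws1 ++ ws2) s].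
Proof.
have [eta [etaM etaS]] := reflection_cocycle.
have eta1 t : eta 1 t = false.
  by have:= etaM 1 1 t; rewrite mulg1 conjg1 addbb.
have exch ws t : all [in S] ws -> eta (\prod_(s <- ws) s) t ->
    exists ws1 s ws2, ws = ws1 ++ s :: ws2
      /\ t * \prod_(s <- ws) s = \prod_(s <- ws1 ++ ws2) s.
  elim: ws t => [|s ws IHws] t /=; first by rewrite big_nil eta1.
  case/andP=> Ss wsS; rewrite big_cons etaM etaS //.
  have [-> _|_ /= /(IHws _ wsS)[ws1 [s' [ws2 [-> eq_t]]]]] := eqVneq t s.
    by exists [::], s, ws; rewrite (cox_mulKg HS).
  exists (s :: ws1), s', ws2; split=> //=; rewrite big_cons -eq_t.
  by rewrite conjgE !mulgA mulgV mul1g.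
exists eta; split=> // w t refl_t.
have eta_lt u : eta u t -> (len (t * u) < len u)%N.
  have [us [usS sz_us def_u]] := reduced_word HS u.
  rewrite -{1}def_u => /(exch _ _ usS)[us1 [s [us2 [def_us]]]].
  rewrite def_u -sz_us def_us => ->; rewrite size_cat /= addnS ltnS -size_cat.
  rewrite len_word //; move: usS.
  by rewrite def_us !all_cat /= => /and3P[-> _ ->].
(* In [u^-1 * s * u] the contributions of [u^-1] and [u] cancel, leaving that of [s]. *)
have eta_t : eta t t.
  case/imset2P: refl_t => s u Ss _ ->.
  have := etaM u^-1 u (s ^ u); rewrite mulVg eta1 conjgK => /esym.
  rewrite {2}conjgE !etaM conjgK (etaS s) // eqxx [s ^ s]conjgE mulKg.
  by case: (eta _ _); case: (eta _ _).
apply/idP/idP=> [/eta_lt //|]; apply: contraTT => not_eta.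
have := eta_lt (t * w); rewrite etaM eta_t conjgE mulKg (negPf not_eta).
by rewrite reflection_mulKg // => /(_ isT) /ltnW; rewrite -leqNgt.
Qed.

(* The right-hand sides say that the inversion set of [u * v] is the symmetric
   difference of that of [u] and of a conjugate of that of [v]. *)
Lemma inversionM u v t : t \in refl ->
  (len (t * (u * v)) < len (u * v))%N =
    (len (t * u) < len u)%N (+) (len (t ^ u * v) < len v)%N.
Proof.
have [eta [etaM eta_len _] refl_t] := exchange_cocycle.
by rewrite -!eta_len ?reflectionsJ.
Qed.

Lemma strong_exchange ws t : all [in S] ws -> t \in refl ->
    (len (t * \prod_(s <- ws) s) < len (\prod_(s <- ws) s))%N ->
  exists ws1 s ws2, ws = ws1 ++ s :: ws2
    /\ t * \prod_(s <- ws) s = \prod_(s <- ws1 ++ ws2) s.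
Proof.
have [eta [_ eta_len exch] wsS refl_t] := exchange_cocycle.
by rewrite -eta_len //; apply: exch.
Qed.

(** The inversion rule for the product [t * w]: since [t] is an inversion of itself, exactly one of
    the two strict inequalities between [w] and [t * w] holds. *)
Lemma len_reflection_neq w t : t \in refl -> len (t * w) != len w.
Proof.
move=> refl_t; have := inversionM t w refl_t.
rewrite reflection_mulKg // reflection_sqr // len1 // conjgE mulKg.
rewrite lt0n len_eq0 //.
case: eqP => [t1|_]; last by case: ltngtP.
case/imset2P: refl_t t1 => s u Ss _ -> /eqP.
by rewrite conjg_eq1 (negPf (cox_neq1 HS Ss)).
Qed.

Lemma len_descentP s w : s \in S ->
  if (len (s * w) < len w)%N then len w = (len (s * w)).+1
  else len (s * w) = (len w).+1.
Proof.
move=> Ss; have := len_reflection_neq w (gen_reflections Ss).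
have := len_genM HS w Ss; have := len_genM_ge HS w Ss.
by case: ltngtP => // *; lia.
Qed.

End Inversions.
(** * Parabolic subgroups *)

Section Parabolic.
Variables (W : finGroupType) (S : {set W}).
Hypothesis HS : coxeter_system S.
Local Notation len := (cox_len S).
Implicit Types (c d m u v w t s : W) (I J K : {set W}).

(** The exchange property only deletes letters, so reducing a word in [J] never leaves [J]; hence
    the length relative to [J] agrees with the length relative to [S]. *)
Lemma parabolic_word J ws : J \subset S -> all [in J] ws ->
  exists us, [/\ all [in J] us, size us = len (\prod_(s <- ws) s)
    & \prod_(s <- us) s = \prod_(s <- ws) s].
Proof.
move=> sJS; have JS us : all [in J] us -> all [in S] us.
  by apply: sub_all => s; apply: (subsetP sJS).
elim: ws => [|s ws IHws] /=; first by exists [::]; rewrite big_nil len1.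
case/andP=> Js /IHws[us [usJ sz_us def_us]]; have Ss := subsetP sJS s Js.
rewrite big_cons -def_us; rewrite -def_us in sz_us.
have := len_descentP HS (\prod_(s <- us) s) Ss; case: ifP => [lt_s sz|_ ->].
  have [us1 [x [us2 [eq_us eq_su]]]] :=
    strong_exchange HS (JS _ usJ) (gen_reflections Ss) lt_s.
  exists (us1 ++ us2); rewrite eq_su; split=> //.
    by move: usJ; rewrite eq_us !all_cat /= => /and3P[-> _ ->].
  apply/eqP; rewrite -eqSS -eq_su -sz -sz_us eq_us !size_cat.
  by rewrite addnS.
by exists (s :: us); rewrite /= Js sz_us big_cons.
Qed.

Lemma parabolic_ind J (P : W -> Prop) : J \subset S -> P 1 ->
    (forall s c, s \in J -> c \in <<J>> -> len (s * c) = (len c).+1 -> P c ->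
       P (s * c)) ->
  forall c, c \in <<J>> -> P c.
Proof.
move=> sJS P1 PM c /mem_gen_word[ws wsJ <-].
have [us [usJ]] := parabolic_word sJS wsJ => + eq_us; rewrite -eq_us.
elim: us usJ {eq_us} => [|s us IHus] /=; first by rewrite big_nil.
case/andP=> Js usJ; rewrite big_cons => sz_us.
have Ss := subsetP sJS s Js; have usS : all [in S] us.
  by apply: sub_all usJ => t; apply: (subsetP sJS).
have sz_eq : size us = len (\prod_(j <- us) j).
  apply/eqP; rewrite eqn_leq len_word // andbT -ltnS sz_us len_genM //.
by apply: PM; rewrite ?word_mem_gen -?sz_us ?sz_eq //; apply: IHus.
Qed.

Lemma parabolic_gens J s : J \subset S -> s \in S -> s \in <<J>> -> s \in J.
Proof.
move=> sJS Ss /mem_gen_word[ws wsJ def_s].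
have [us [usJ]] := parabolic_word sJS wsJ; rewrite def_s len_gen //.
case: us usJ => [|x [|? ?]] //=; rewrite big_seq1 andbT => + _.
by move=> + <-.
Qed.

Lemma parabolic_setI J : J \subset S -> S :&: <<J>> = J.
Proof.
move=> sJS; apply/setP=> s; rewrite inE; apply/andP/idP=> [[Ss]|Js].
  exact: parabolic_gens.
by rewrite (subsetP sJS) ?mem_gen.
Qed.

(** [J] is recovered as the set of generators lying in [<<J>>], so whichever set [pick] returns is
    [J]. *)
Lemma parabolic_typeE J : J \subset S -> parabolic_type S <<J>> = J.
Proof.
move=> sJS; rewrite /parabolic_type.
case: pickP => [K /andP[sKS /eqP eqKJ]|/(_ J)]; last by rewrite sJS eqxx.
by rewrite /= -[K]parabolic_setI // eqKJ parabolic_setI.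
Qed.

Lemma parabolic_left_descent J s c :
  J \subset S -> s \in S -> c \in <<J>> -> (len (s * c) < len c)%N -> s \in J.
Proof.
move=> sJS Ss /mem_gen_word[ws wsJ <-] lt_s.
have wsS : all [in S] ws by apply: sub_all wsJ => t; apply: (subsetP sJS).
have [ws1 [x [ws2 [def_ws def_s]]]] :=
  strong_exchange HS wsS (gen_reflections Ss) lt_s.
apply: parabolic_gens => //.
rewrite -[s](mulgK (\prod_(j <- ws) j)) def_s groupM ?groupV ?word_mem_gen //.
by move: wsJ; rewrite def_ws !all_cat /= => /and3P[-> _ ->].
Qed.

Lemma parabolic_descent J c : J \subset S -> c \in <<J>> -> c != 1 ->
  exists s d, [/\ s \in J, d \in <<J>>, c = s * d & len c = (len d).+1].
Proof.
move=> sJS; move: c; apply: parabolic_ind => // [|s d Js Jd len_sd _ _].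
  by rewrite eqxx.
by exists s, d.
Qed.

(** Length-additive form of being shortest in the coset [m <<J>>]; [max_right] is the subtractive
    form of being longest. Both turn coset questions into linear arithmetic. *)
Definition min_right J m :=
  forall c, c \in <<J>> -> len (m * c) = (len m + len c)%N.

Definition max_right J v :=
  forall c, c \in <<J>> -> (len (v * c) + len c)%N = len v.

(** If a letter [s] prolongs [c] but shortens [c * m^-1], the inversion rule makes [s ^ c] an
    inversion of [m^-1]; as [s ^ c] lies in [<<J>>], this would give a shorter element of
    [m <<J>>]. *)
Lemma min_rightP J m : J \subset S ->
  (forall c, c \in <<J>> -> (len m <= len (m * c))%N) -> min_right J m.
Proof.
move=> sJS min_m; suffices minV c : c \in <<J>> ->
    len (c * m^-1) = (len c + len m)%N.
  move=> c Jc; rewrite -(lenV HS) invgM minV ?groupV //.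
  by rewrite (lenV HS) addnC.
move: c; apply: parabolic_ind => // [|s c Js Jc len_sc IHc].
  by rewrite mul1g (lenV HS) len1.
have Ss := subsetP sJS s Js; have refl_s := gen_reflections Ss.
have not_lt : (len (s ^ c * m^-1) < len m^-1)%N = false.
  apply/negbTE; rewrite -leqNgt (lenV HS m) -[len (s ^ c * _)](lenV HS).
  by rewrite invgM invgK min_m // groupV groupJ // mem_gen.
have := len_descentP HS (c * m^-1) Ss.
by rewrite inversionM // len_sc not_lt ltnNge leqnSn /= mulgA IHc.
Qed.

(** Every letter of a reduced word of [c] shortens [c^-1 * v^-1] further, by the inversion rule
    applied to [v^-1 = c * (c^-1 * v^-1)]; the triangle inequality prevents a larger drop. *)
Lemma max_rightP J v : J \subset S ->
  (forall s, s \in J -> (len (v * s) <= len v)%N) -> max_right J v.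
Proof.
move=> sJS max_v; suffices maxV c : c \in <<J>> ->
    (len (c^-1 * v^-1) + len c)%N = len v.
  by move=> c Jc; rewrite -[len (v * c)](lenV HS) invgM maxV.
move: c; apply: parabolic_ind => // [|s c Js Jc len_sc IHc].
  by rewrite invg1 mul1g len1 // addn0 (lenV HS).
have Ss := subsetP sJS s Js; have refl_s := gen_reflections Ss.
have := inversionM HS c (c^-1 * v^-1) refl_s.
rewrite mulKVg len_sc [X in X (+) _]ltnNge leqnSn /=.
have -> : s ^ c * (c^-1 * v^-1) = (s * c)^-1 * v^-1.
  by rewrite conjgE invgM (cox_inv HS Ss) !mulgA mulgK.
have -> : (len (s * v^-1) < len v^-1)%N.
  rewrite ltn_neqAle len_reflection_neq //.
  by rewrite (lenV HS) (len_genMV HS) ?max_v.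
move=> lt_s.
apply/eqP; rewrite eqn_leq; apply/andP; split.
  by move: lt_s => /esym; lia.
by rewrite -len_sc -(lenV HS v) addnC -{1}[v^-1](mulKVg (s * c)) (lenM HS).
Qed.

Lemma min_right_coset J w : J \subset S ->
  exists m c, [/\ min_right J m, c \in <<J>> & w = m * c].
Proof.
move=> sJS; have Jw : w \in w *: <<J>> by rewrite lcoset_refl.
have [m /= Jm min_m] := @arg_minnP _ w [in w *: <<J>>] len Jw.
exists m, (m^-1 * w); rewrite mulKVg; split=> //; last first.
  by rewrite -mem_lcoset lcoset_sym.
apply: min_rightP => // c Jc; apply: min_m.
by rewrite mem_lcoset mulgA groupM // -mem_lcoset.
Qed.

(** Write [d = m * c] with [m] shortest. If [c] were nontrivial, removing its last letter would
    shorten [d]. *)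
Lemma min_right_gens J d : J \subset S ->
  (forall s, s \in J -> (len d < len (d * s))%N) -> min_right J d.
Proof.
move=> sJS min_d; have [m [c [min_m Jc def_d]]] := min_right_coset d sJS.
have [c1|nt_c] := eqVneq c 1; first by rewrite def_d c1 mulg1.
have [||s [b [Js Jb def_c len_c]]] := @parabolic_descent J c^-1 sJS.
- by rewrite groupV.
- by rewrite invg_eq1.
have Ss := subsetP sJS s Js.
have := min_d s Js.
rewrite def_d -mulgA !min_m ?groupM ?(mem_gen Js) //.
by rewrite ltn_add2l -(len_genMV HS) // -(lenV HS c) len_c def_c (cox_mulKg HS)
           // ltnNge leqnSn.
Qed.

(** By exchange, a generator that shortens an element of [<<I>>] belongs to [I], hence not to
    [J]. *)
Lemma parabolic_disjoint_min I J c : I \subset S -> J \subset S ->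
  [disjoint I & J] -> c \in <<I>> -> min_right J c.
Proof.
move=> sIS sJS dIJ Ic; apply: min_right_gens => // s Js.
have Ss := subsetP sJS s Js; have := len_descentP HS c^-1 Ss.
have: s \notin I by apply: contraL Js => Is; rewrite (disjointFr dIJ).
rewrite (len_genMV HS) //.
rewrite (lenV HS); case: ifP => [lt_s /negP[]|_ _ ->] //.
apply: (@parabolic_left_descent I s c^-1); rewrite ?groupV //.
by rewrite (len_genMV HS) // (lenV HS).
Qed.

Definition longest_in J : W := [arg max_(w > 1 in <<J>>) len w].

Lemma longest_inP J : J \subset S ->
  [/\ longest_in J \in <<J>>, max_right J (longest_in J)
    & forall c, c \in <<J>> -> (len c <= len (longest_in J))%N].
Proof.
move=> sJS; rewrite /longest_in.
case: arg_maxnP => [|v Jv max_v]; first exact: group1.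
split=> //; apply: max_rightP => // s Js.
by apply: max_v; rewrite groupM ?(mem_gen Js).
Qed.

End Parabolic.
(** * Longest elements and the Bruhat order *)

Section Bruhat.
Variables (W : finGroupType) (S : {set W}).
Hypothesis HS : coxeter_system S.
Local Notation len := (cox_len S).
Local Notation w0 := (longest S).
Local Notation wl := (longest_in S).
Implicit Types (a c d g m u v w x y t s : W) (A B I J K : {set W}).

Lemma longest_max : max_right S S w0.
Proof.
apply: max_rightP => // s Ss; rewrite /longest.
by case: arg_maxnP => // v _; apply.
Qed.

Lemma len_longestM d : (len (w0 * d) + len d)%N = len w0.
Proof. by apply: longest_max; apply: (cox_mem_gen HS). Qed.

Lemma longest_sqr : w0 * w0 = 1.
Proof. by apply/eqP; rewrite -(len_eq0 HS); have := len_longestM w0; lia. Qed.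

Lemma longest_inv : w0^-1 = w0.
Proof. by apply: (mulgI w0); rewrite mulgV longest_sqr. Qed.

Lemma len_Mlongest d : (len (d * w0) + len d)%N = len w0.
Proof.
by rewrite -(lenV HS) invgM longest_inv -[len d](lenV HS) len_longestM.
Qed.

Lemma longestJE w : w ^ w0 = w0 * w * w0.
Proof. by rewrite conjgE longest_inv mulgA. Qed.

Lemma longestJK : involutive (conjg^~ w0).
Proof. by move=> w; rewrite -conjgM longest_sqr conjg1. Qed.

Lemma longestJsK A : (A :^ w0) :^ w0 = A.
Proof. by rewrite -conjsgM longest_sqr conjsg1. Qed.

Lemma len_longestJ w : len (w ^ w0) = len w.
Proof.
by rewrite longestJE; have := len_Mlongest (w0 * w); have := len_longestM w; lia.
Qed.

Lemma longest_conj_gens J : J \subset S -> J :^ w0 \subset S.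
Proof.
move=> sJS; apply/subsetP=> _ /imsetP[s Js ->].
by apply: (len_eq1 HS); rewrite len_longestJ (len_gen HS) // (subsetP sJS).
Qed.

Lemma longest_in_max J v : J \subset S -> v \in <<J>> -> max_right S J v ->
  v = wl J.
Proof.
move=> sJS Jv max_v; have [Jw max_w w_ge] := longest_inP HS sJS.
have: v * wl J = 1.
  by apply/eqP; rewrite -(len_eq0 HS); have := w_ge v Jv; have := max_v _ Jw; lia.
have: wl J * wl J = 1.
  by apply/eqP; rewrite -(len_eq0 HS); have := max_w _ Jw; lia.
by move=> <- /mulIg.
Qed.

Lemma longest_in_sqr J : J \subset S -> wl J * wl J = 1.
Proof.
move=> sJS; have [Jw max_w _] := longest_inP HS sJS.
by apply/eqP; rewrite -(len_eq0 HS); have := max_w _ Jw; lia.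
Qed.

Lemma longest_in_inv J : J \subset S -> (wl J)^-1 = wl J.
Proof. by move=> sJS; apply: (mulgI (wl J)); rewrite mulgV longest_in_sqr. Qed.

Lemma longest_inJ J : J \subset S -> wl (J :^ w0) = (wl J) ^ w0.
Proof.
move=> sJS; have [Jw max_w w_ge] := longest_inP HS sJS.
symmetry; apply: longest_in_max; first exact: longest_conj_gens.
  by rewrite genJ memJ_conjg.
move=> _ /[!genJ] /imsetP[c Jc ->].
by rewrite -conjMg !len_longestJ max_w.
Qed.

Lemma min_right_longest_in J v : J \subset S -> max_right S J v ->
  min_right S J (v * wl J).
Proof.
move=> sJS max_v; have [Jw max_w _] := longest_inP HS sJS => c Jc.
have -> : v * wl J * c = v * (wl J * c) by rewrite mulgA.
have := max_v _ Jw; have := max_v _ (groupM Jw Jc); have := max_w c Jc.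
by lia.
Qed.

(** Right multiplication by [w0] reverses length and carries the coset of [a] modulo [J :^ w0] to
    that of [a * w0] modulo [J]. *)
Lemma max_right_longest J a : J \subset S ->
  min_right S (J :^ w0) a -> max_right S J (a * w0).
Proof.
move=> sJS min_a d Jd.
have -> : a * w0 * d = a * d ^ w0 * w0.
  by rewrite longestJE -!mulgA longest_sqr mulg1.
have := len_Mlongest (a * d ^ w0); have := len_Mlongest a.
rewrite (min_a (d ^ w0)) ?genJ ?memJ_conjg // len_longestJ. lia.
Qed.

Lemma bruhat_step_reflection u t :
  t \in reflections S -> (len u < len (u * t))%N -> bruhat S u (u * t).
Proof.
move=> refl_t lt_u; apply/connect1/andP; split=> //.
by apply/existsP; exists t; rewrite refl_t eqxx.
Qed.

Lemma bruhat_refl u : bruhat S u u.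
Proof. exact: connect0. Qed.

Lemma bruhat_trans v u w : bruhat S u v -> bruhat S v w -> bruhat S u w.
Proof. exact: connect_trans. Qed.

Lemma bruhat_len u v : bruhat S u v -> (len u <= len v)%N.
Proof.
case/connectP=> p; elim: p u => [|w p IHp] u /=; first by move=> _ ->.
case/andP=> /andP[_ lt_u] path_p def_v.
exact: leq_trans (ltnW lt_u) (IHp w path_p def_v).
Qed.

Lemma bruhat_eq u v : bruhat S u v -> (len v <= len u)%N -> u = v.
Proof.
case/connectP=> [[|w p] /= path_p -> //] le_vu.
case/andP: path_p => /andP[_ lt_u] path_p.
have /bruhat_len le_wv : bruhat S w (last w p) by apply/connectP; exists p.
by have := leq_trans lt_u (leq_trans le_wv le_vu); rewrite ltnn.
Qed.

Lemma bruhat_anti u v : bruhat S u v -> bruhat S v u -> u = v.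
Proof. by move=> le_uv /bruhat_len; apply: bruhat_eq. Qed.

(** Inversion turns right multiplication by a reflection into left multiplication, which is right
    multiplication by a conjugate reflection. *)
Lemma bruhatV u v : bruhat S u v -> bruhat S u^-1 v^-1.
Proof.
case/connectP=> p; elim: p u => [|w p IHp] u /=.
  by move=> _ ->; apply: bruhat_refl.
case/andP=> /andP[/existsP[t /andP[refl_t /eqP def_w]] lt_u] path_p def_v.
apply: bruhat_trans (IHp w path_p def_v).
have -> : w^-1 = u^-1 * t ^ u^-1.
  by rewrite conjgE invgK mulKg def_w invgM (reflection_inv HS refl_t).
apply: bruhat_step_reflection; first exact: reflectionsJ.
have -> : u^-1 * t ^ u^-1 = w^-1.
  by rewrite conjgE invgK mulKg def_w invgM (reflection_inv HS refl_t).
by rewrite !(lenV HS).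
Qed.

Lemma bruhat_min_right J m c : J \subset S -> min_right S J m -> c \in <<J>> ->
  bruhat S m (m * c).
Proof.
(* The induction adds letters on the left; passing to [c^-1] makes them appear at the right end of
   [m * c]. *)
move=> sJS min_m; rewrite -[c]invgK groupV; move: c^-1 => {}c.
move: c; apply: (parabolic_ind HS) => // [|s c Js Jc len_sc le_m].
  by rewrite invg1 mulg1 bruhat_refl.
have Ss := subsetP sJS s Js; apply: bruhat_trans le_m _.
have eq_sc : m * (s * c)^-1 = m * c^-1 * s.
  by rewrite invgM (cox_inv HS Ss) mulgA.
rewrite eq_sc; apply: bruhat_step_reflection; first exact: gen_reflections.
rewrite -eq_sc !min_m ?groupV ?groupM ?(mem_gen Js) //.
by rewrite !(lenV HS) len_sc ltn_add2l.
Qed.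

(** The bridge from the Bruhat-minimum definition of the representatives to length arithmetic. *)
Lemma min_lcosetsP J m : J \subset S ->
  reflect (min_right S J m) (m \in min_lcosets S J).
Proof.
move=> sJS; rewrite inE; apply: (iffP idP) => [/andP[_ /forall_inP min_m] | min_m].
  apply: (min_rightP HS) => // c Jc; apply: bruhat_len; apply: min_m.
  by rewrite mem_lcoset mulKg.
rewrite /bruhat_min lcoset_refl; apply/forall_inP=> w; rewrite mem_lcoset => Jw.
by rewrite -[w](mulKVg m) (bruhat_min_right sJS).
Qed.

Lemma min_rcosets_inv J y :
  (y \in min_rcosets S J) = (y^-1 \in min_lcosets S J).
Proof.
rewrite !inE /bruhat_min rcoset_refl lcoset_refl /=.
apply/forall_inP/forall_inP=> min_y w Jw.
  rewrite -[w]invgK bruhatV // min_y //.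
  by move: Jw; rewrite mem_lcoset mem_rcoset invgK -groupV invgM.
rewrite -[y]invgK -[w]invgK bruhatV // min_y //.
by move: Jw; rewrite mem_lcoset mem_rcoset -groupV invgM.
Qed.

(** Write [x = v * g * wl A]; then [g] is in [<<J>>], is shortest modulo [A], and [x] has length
    [len v - len g - len (wl A)]. Removing the first letter of [g] keeps it shortest and multiplies
    [x] by a reflection that lengthens it, so one climbs to [g = 1]. *)
Lemma bruhat_coset_max A J v x : A \subset J -> J \subset S ->
    max_right S J v -> min_right S A x -> v^-1 * x \in <<J>> ->
  bruhat S x (v * wl A).
Proof.
move=> sAJ sJS max_v min_x Jx; have sAS := subset_trans sAJ sJS.
have [Aw max_wA _] := longest_inP HS sAS; have sAJg := genS sAJ.
pose g : W := v^-1 * x * wl A.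
have def_x : x = v * g * wl A.
  by rewrite /g mulgA mulKVg -mulgA longest_in_sqr // mulg1.
have Jg : g \in <<J>> by rewrite groupM // (subsetP sAJg).
have min_g : min_right S A g.
  move=> c Ac; have Jc := subsetP sAJg c Ac.
  have Jgc : g * c \in <<J>> by apply: groupM.
  have Awc : wl A * c \in <<A>> by apply: groupM.
  have := max_v _ Jgc; have := max_v g Jg.
  have -> : v * (g * c) = x * (wl A * c) by rewrite /g -!mulgA mulKVg.
  have -> : v * g = x * wl A by rewrite /g mulgA mulKVg.
  have := min_x _ Aw; have := min_x _ Awc; have := max_wA c Ac.
  by clear; lia.
rewrite def_x; move: g Jg min_g {def_x}; apply: (parabolic_ind HS) => //.
  by rewrite mulg1 bruhat_refl.
move=> s g Js Jg len_sg IHg min_sg; have Ss := subsetP sJS s Js.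
have min_g : min_right S A g.
  apply: (min_rightP HS) => // c Ac; have := min_sg c Ac.
  have -> : s * g * c = s * (g * c) by rewrite mulgA.
  by move: len_sg; have := len_genM HS (g * c) Ss; clear; lia.
apply: bruhat_trans (IHg min_g).
(* The reflection [s ^ (g * wl A)] on the right cancels the letter [s] in front of [g]. *)
have eq_g : v * (s * g) * wl A * s ^ (g * wl A) = v * g * wl A.
  by rewrite conjgE invgM !mulgA !mulgK -(mulgA v) (cox_sqr HS Ss) mulg1.
rewrite -eq_g; apply: bruhat_step_reflection; first exact: mem_reflections.
rewrite eq_g.
have JwA : wl A \in <<J>> by apply: (subsetP sAJg).
have Jsg : s * g \in <<J>> by rewrite groupM ?(mem_gen Js).
have Jgw : g * wl A \in <<J>> by apply: groupM.
have Jsgw : s * g * wl A \in <<J>> by apply: groupM.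
have -> : v * (s * g) * wl A = v * (s * g * wl A) by rewrite !mulgA.
have -> : v * g * wl A = v * (g * wl A) by rewrite mulgA.
have := max_v _ Jsgw; have := max_v _ Jgw.
by rewrite (min_g _ Aw) (min_sg _ Aw) len_sg; clear; lia.
Qed.

Lemma bruhat1 w : bruhat S 1 w.
Proof.
rewrite -[w]mul1g; apply: (@bruhat_min_right S) => // [c _|].
  by rewrite mul1g len1.
exact: cox_mem_gen.
Qed.

(** [bruhat_coset_max] for the whole group, with [v = w0] and [J] as the small parabolic, read
    through inverses. *)
Lemma bruhat_min_rcosets J y : J \subset S -> y \in min_rcosets S J ->
  bruhat S y (wl J * w0).
Proof.
move=> sJS; rewrite min_rcosets_inv => /(min_lcosetsP _ sJS) min_y.
rewrite -[y]invgK -[wl J]longest_in_inv // -[w0]longest_inv -invgM.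
apply/bruhatV/(bruhat_coset_max sJS (subxx S) longest_max min_y).
exact: cox_mem_gen.
Qed.

(** The length of [v * z * wl A * c] is [len v - len z - len (wl A * c)], and [len (wl A * c)] is
    itself [len (wl A) - len c]: the two subtractions make the length additive in [c]. *)
Lemma min_right_max_low A J v z : A \subset J -> J \subset S ->
    max_right S J v -> z \in <<J>> -> min_right S A z ->
  min_right S A (v * z * wl A).
Proof.
move=> sAJ sJS max_v Jz min_z c Ac; have sAJg := genS sAJ.
have [Aw max_wA _] := longest_inP HS (subset_trans sAJ sJS).
have Awc : wl A * c \in <<A>> by apply: groupM.
have Jzw : z * wl A \in <<J>> by rewrite groupM // (subsetP sAJg).
have Jzwc : z * (wl A * c) \in <<J>> by rewrite groupM // (subsetP sAJg).
have -> : v * z * wl A * c = v * (z * (wl A * c)) by rewrite !mulgA.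
have -> : v * z * wl A = v * (z * wl A) by rewrite !mulgA.
have := max_v _ Jzw; have := max_v _ Jzwc; have := max_wA c Ac.
by rewrite (min_z _ Aw) (min_z _ Awc); clear; lia.
Qed.

(* In fact [w_J w_A] is the longest element of [W_B]. *)
Lemma longest_in_prod A B J :
    J \subset S -> B \subset S -> A \subset S -> [disjoint B & A] ->
  <<J>> = <<B>> * <<A>> -> wl J * wl A \in <<B>>.
Proof.
move=> sJS sBS sAS dBA defJ; have [Jw max_w _] := longest_inP HS sJS.
have := Jw; rewrite defJ => /mulsgP[b c Bb Ac def_w].
have min_b : min_right S A b by apply: (parabolic_disjoint_min HS) Bb.
have max_c : max_right S A c.
  move=> d Ad; have Acd : c * d \in <<A>> by apply: groupM.
  have Jd : d \in <<J>> by rewrite defJ -[d]mul1g mem_mulg.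
  have len_w : len (wl J) = (len b + len c)%N by rewrite def_w min_b.
  have len_wd : len (wl J * d) = (len b + len (c * d))%N.
    by rewrite def_w -mulgA min_b.
  by apply/eqP; rewrite -(eqn_add2l (len b)) addnA -len_wd -len_w max_w.
rewrite def_w (longest_in_max sAS Ac max_c).
by rewrite -mulgA longest_in_sqr // mulg1.
Qed.

(** Because [W_{J^w0} w0 = w0 W_J], the double coset collapses to the left coset [w0 W_J]. Taken at
    [lambda] and at [lambda_*], this gives both extremal values of [sigma_0]. *)
Lemma min_dcoset_conj J : J \subset S ->
  min_dcoset S (J :^ w0) w0 J = w0 * wl J.
Proof.
move=> sJS; rewrite /min_dcoset.
have -> : <<J :^ w0>> * [set w0] * <<J>> = w0 *: <<J>> :> {set W}.
  rewrite genJ conjsgE longest_inv -!mulgA; congr (_ * _).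
  by rewrite !mulgA -rcosetM longest_sqr rcoset1 mulGid.
have [Jw _ _] := longest_inP HS sJS.
have : bruhat_min S (w0 *: <<J>>) (w0 * wl J).
  have /(min_lcosetsP _ sJS) := min_right_longest_in sJS (fun d Jd => len_longestM d).
  by rewrite inE lcosetM (lcoset_id Jw).
case: pickP => [v | /(_ (w0 * wl J)) -> //].
case/andP=> /= Jv /forall_inP min_v /andP[Jw0 /forall_inP min_w0].
by apply: bruhat_anti; [apply: min_v | apply: min_w0].
Qed.

Lemma min_dcoset_conjV J : J \subset S ->
  min_dcoset S J w0 (J :^ w0) = wl J * w0.
Proof.
move=> sJS; rewrite -{1}[J]longestJsK min_dcoset_conj ?longest_conj_gens //.
by rewrite longest_inJ // longestJE !mulgA longest_sqr mul1g.
Qed.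

Lemma min_dcosetV I J : (min_dcoset S I w0 J)^-1 = min_dcoset S J w0 I.
Proof.
have minV A v : bruhat_min S A v = bruhat_min S A^-1 v^-1.
  rewrite /bruhat_min mem_invg invgK; congr (_ && _).
  apply/forall_inP/forall_inP=> min_v w Aw.
    by rewrite -[w]invgK bruhatV // min_v // -mem_invg.
  by rewrite -[v]invgK -[w]invgK bruhatV // min_v // mem_invg invgK.
have setV : (<<I>> * [set w0] * <<J>>)^-1 = <<J>> * [set w0] * <<I>> :> {set W}.
  by rewrite !invMg !invGid invg_set1 longest_inv mulgA.
rewrite /min_dcoset; case: pickP => [u min_u | no_u]; case: pickP => [v min_v | no_v].
- move: min_u; rewrite /= minV setV => /andP[Ju /forall_inP min_u].
  case/andP: min_v => Jv /forall_inP min_v.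
  by apply: bruhat_anti; [apply: min_u | apply: min_v].
- by have := no_v u^-1; rewrite -setV -minV min_u.
- by have := no_u v^-1; rewrite minV invgK setV min_v.
(* With arbitrary [I] and [J] neither minimum may exist; then both sides are the default [w0], an
   involution. *)
- exact: longest_inv.
Qed.

End Bruhat.

(** * Factorizable monoids *)

Section Units.
Variable R : finMonoidType.
Implicit Types (r e f : R) (u v w : munits R).

Lemma muvalM u v : ((u * v : munits R) : R) = (u : R) * (v : R).
Proof. by []. Qed.

Lemma munit_mulgV u : (u : R) * ((u^-1 : munits R) : R) = 1.
Proof. by rewrite -muvalM mulgV. Qed.

Lemma munit_mulVg u : ((u^-1 : munits R) : R) * (u : R) = 1.
Proof. by rewrite -muvalM mulVg. Qed.

Lemma munitK u r : ((u^-1 : munits R) : R) * ((u : R) * r) = r.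
Proof. by rewrite mulgA munit_mulVg mul1g. Qed.

Lemma munitKV u r : (u : R) * (((u^-1 : munits R) : R) * r) = r.
Proof. by rewrite mulgA munit_mulgV mul1g. Qed.

Lemma munitI u r r' : (u : R) * r = (u : R) * r' -> r = r'.
Proof. by move=> eq_r; rewrite -[r](munitK u) eq_r munitK. Qed.

Lemma munitIr u r r' : r * (u : R) = r' * (u : R) -> r = r'.
Proof.
by move=> eq_r; rewrite -[r]mulg1 -(munit_mulgV u) mulgA eq_r -mulgA
  munit_mulgV mulg1.
Qed.

Definition uconj u e : R := (u : R) * e * ((u^-1 : munits R) : R).

Lemma uconjE u e : uconj u e * (u : R) = (u : R) * e.
Proof. by rewrite /uconj -mulgA munit_mulVg mulg1. Qed.

Lemma uconj1 e : uconj 1 e = e.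
Proof. by apply: (@munitIr 1); rewrite uconjE mulg1 mul1g. Qed.

Lemma uconjM u v e : uconj (u * v) e = uconj u (uconj v e).
Proof.
apply: (@munitIr (u * v)); rewrite uconjE !muvalM [RHS]mulgA uconjE.
by rewrite -[RHS]mulgA uconjE mulgA.
Qed.

Lemma uconjMm u e f : uconj u (e * f) = uconj u e * uconj u f.
Proof.
apply: (@munitIr u); rewrite uconjE -[RHS]mulgA uconjE mulgA.
by rewrite [RHS]mulgA uconjE.
Qed.

Lemma uconjVK u e : uconj u^-1 (uconj u e) = e.
Proof. by rewrite -uconjM mulVg uconj1. Qed.

Lemma uconj_fix u e : (u \in fixW e) = (uconj u e == e).
Proof.
rewrite inE; apply/eqP/eqP=> eq_e; last by rewrite -uconjE eq_e.
by apply: (@munitIr u); rewrite uconjE.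
Qed.

Lemma idem_leP e f : reflect (e * f = e /\ f * e = e) (idem_le e f).
Proof. by apply: (iffP andP) => [[/eqP ? /eqP ?] | [-> ->]]. Qed.

Lemma idem_le_anti e f : idem_le e f -> idem_le f e -> e = f.
Proof. by case/idem_leP=> _ + /idem_leP[+ _] => -> . Qed.

Lemma idem_le_trans f e g : idem_le e f -> idem_le f g -> idem_le e g.
Proof.
case/idem_leP=> ef fe /idem_leP[fg gf]; apply/idem_leP; split.
  by rewrite -{1}ef -mulgA fg.
by rewrite -{1}fe mulgA gf.
Qed.

Lemma idem_le_conj u e f : idem_le e f -> idem_le (uconj u e) (uconj u f).
Proof.
by case/idem_leP=> ef fe; apply/idem_leP; rewrite -!uconjMm ef fe.
Qed.

Lemma uconj_idem u e : e \in @idempotents R -> uconj u e \in @idempotents R.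
Proof. by rewrite !inE -uconjMm => /eqP->. Qed.

(* [e <= u e u^-1 <= u^2 e u^-2 <= ...] returns to [e], as [u] has finite order. *)
Lemma idem_le_conj_eq u e : e \in @idempotents R ->
  idem_le e (uconj u e) -> uconj u e = e.
Proof.
rewrite inE => /eqP ee le_e.
have le_n n : idem_le (uconj u e) (uconj (u ^+ n.+1) e).
  elim: n => [|n IHn]; first by rewrite expg1; apply/idem_leP; rewrite -uconjMm ee.
  by rewrite expgS uconjM; apply: idem_le_conj; apply: idem_le_trans le_e IHn.
apply: idem_le_anti => //; have := le_n #[u].-1.
by rewrite prednK // expg_order uconj1.
Qed.

Lemma greenJP r s :
  reflect ((exists a b, r = a * s * b) /\ (exists a b, s = a * r * b)) (greenJ r s).
Proof.
apply: (iffP eqP) => [eq_rs | [[a [b def_r]] [c [d def_s]]]].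
  split.
    have: r \in [set a * r * b | a : R, b : R].
      by apply/imset2P; exists 1 1; rewrite // mul1g mulg1.
    by rewrite eq_rs => /imset2P[a b _ _ ->]; exists a, b.
  have: s \in [set a * s * b | a : R, b : R].
    by apply/imset2P; exists 1 1; rewrite // mul1g mulg1.
  by rewrite -eq_rs => /imset2P[a b _ _ ->]; exists a, b.
apply/setP=> t; apply/imset2P/imset2P=> [] [x y _ _ ->].
  by exists (x * a) (b * y); rewrite // def_r !mulgA.
by exists (x * c) (d * y); rewrite // def_s !mulgA.
Qed.

Lemma greenLP r s :
  reflect ((exists a, r = a * s) /\ (exists a, s = a * r)) (greenL r s).
Proof.
apply: (iffP eqP) => [eq_rs | [[a def_r] [c def_s]]].
  split.
    have: r \in [set a * r | a : R] by apply/imsetP; exists 1; rewrite // mul1g.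
    by rewrite eq_rs => /imsetP[a _ ->]; exists a.
  have: s \in [set a * s | a : R] by apply/imsetP; exists 1; rewrite // mul1g.
  by rewrite -eq_rs => /imsetP[a _ ->]; exists a.
apply/setP=> t; apply/imsetP/imsetP=> [] [x _ ->].
  by exists (x * a); rewrite // def_r !mulgA.
by exists (x * c); rewrite // def_s !mulgA.
Qed.

Lemma greenRP r s :
  reflect ((exists a, r = s * a) /\ (exists a, s = r * a)) (greenR r s).
Proof.
apply: (iffP eqP) => [eq_rs | [[a def_r] [c def_s]]].
  split.
    have: r \in [set r * a | a : R] by apply/imsetP; exists 1; rewrite // mulg1.
    by rewrite eq_rs => /imsetP[a _ ->]; exists a.
  have: s \in [set s * a | a : R] by apply/imsetP; exists 1; rewrite // mulg1.
  by rewrite -eq_rs => /imsetP[a _ ->]; exists a.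
apply/setP=> t; apply/imsetP/imsetP=> [] [x _ ->].
  by exists (a * x); rewrite // def_r !mulgA.
by exists (c * x); rewrite // def_s !mulgA.
Qed.

Lemma greenJ_units u v r : greenJ ((u : R) * r * (v : R)) r.
Proof.
apply/greenJP; split; first by exists (u : R), (v : R).
exists ((u^-1 : munits R) : R), ((v^-1 : munits R) : R).
by rewrite -!mulgA munit_mulgV mulg1 munitK.
Qed.

Lemma greenJ_sym r s : greenJ r s = greenJ s r.
Proof. exact: eq_sym. Qed.

Lemma greenJ_trans s r t : greenJ r s -> greenJ s t -> greenJ r t.
Proof. by move=> /eqP eq_rs /eqP eq_st; apply/eqP; rewrite eq_rs. Qed.

Lemma greenL_J r s : greenL r s -> greenJ r s.
Proof.
case/greenLP=> [[a def_r] [b def_s]]; apply/greenJP.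
by split; [exists a, 1 | exists b, 1]; rewrite mulg1.
Qed.

Lemma greenR_J r s : greenR r s -> greenJ r s.
Proof.
case/greenRP=> [[a def_r] [b def_s]]; apply/greenJP.
by split; [exists 1, a | exists 1, b]; rewrite mul1g.
Qed.

End Units.

Section FactorizableMonoid.
Variables (R : finMonoidType) (Lam : {set R}) (S : {set munits R}).
Hypothesis HRC : renner_coxeter Lam S.
Local Notation W := (munits R).
Local Notation E := (@idempotents R).
Implicit Types (r s t e f g : R) (u v w x y : W).

Lemma idem_sqr e : e \in E -> e * e = e.
Proof. by rewrite inE => /eqP. Qed.

Lemma idemM e f : e \in E -> f \in E -> e * f \in E.
Proof. by move=> Ee Ef; case: (rc_meet HRC Ee Ef). Qed.

Lemma idem_comm e f : e \in E -> f \in E -> e * f = f * e.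
Proof.
move=> Ee Ef; have [Eef le_e le_f min_ef] := rc_meet HRC Ee Ef.
have [Efe le_f' le_e' min_fe] := rc_meet HRC Ef Ee.
by apply: idem_le_anti; [apply: min_fe | apply: min_ef].
Qed.

Lemma Lam_idem e : e \in Lam -> e \in E.
Proof. exact: subsetP (rc_sub HRC) e. Qed.

Lemma idem_le_of_mull e f : e \in E -> f \in E -> e * f = e -> idem_le e f.
Proof. by move=> Ee Ef ef; apply/idem_leP; rewrite -(idem_comm Ee Ef). Qed.

(** Factor [a = g w] and [b = v h] with idempotents outside, and push all units to the right:
    [e = k u] with [k] an idempotent below [w f w^-1]. Then [k e = e] and [e k = k], so [e = k] by
    commutation. *)
Lemma idem_below_conj e f a b :
  e \in E -> f \in E -> e = a * f * b -> exists w, idem_le e (uconj w f).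
Proof.
move=> Ee Ef def_e; have [[g [w [Eg def_a]]] _] := rc_factor HRC a.
have [_ [v [h [Eh def_b]]]] := rc_factor HRC b.
pose u := w * v; pose k := g * uconj w f * uconj u h.
have Ek : k \in E by apply: idemM; [apply: idemM|]; rewrite ?uconj_idem.
have def_ku : e = k * (u : R).
  rewrite /k -[RHS]mulgA uconjE -[RHS]mulgA muvalM -(mulgA (w : R)).
  by rewrite (mulgA (uconj w f)) uconjE def_e def_a def_b !mulgA.
have def_k : k = e * ((u^-1 : W) : R) by rewrite def_ku -mulgA munit_mulgV mulg1.
have ke : k * e = e by rewrite {1}def_ku mulgA [k * k]idem_sqr.
have ek : e * k = k by rewrite {1}def_k mulgA idem_sqr.
have eq_ek : e = k by rewrite -ke -idem_comm.
exists w; apply: idem_le_of_mull; rewrite ?uconj_idem //.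
have Ew := uconj_idem w Ef; have Eu := uconj_idem u Eh.
rewrite eq_ek /k -[LHS]mulgA [uconj u h * _]idem_comm // [LHS]mulgA.
by rewrite -(mulgA g) [uconj w f * _]idem_sqr.
Qed.

(** Each idempotent lies below a conjugate of the other, so [e] lies below a conjugate of itself,
    which must be [e]; the chain collapses. *)
Lemma greenJ_idem e f : e \in E -> f \in E -> greenJ e f ->
  exists w, e = uconj w f.
Proof.
move=> Ee Ef /greenJP[[a [b def_e]] [c [d def_f]]].
have [w le_ef] := idem_below_conj Ee Ef def_e.
have [v le_fe] := idem_below_conj Ef Ee def_f.
exists w; apply: idem_le_anti => //.
have le_we : idem_le (uconj w f) (uconj (w * v) e).
  by rewrite uconjM; apply: idem_le_conj.
by rewrite -(idem_le_conj_eq Ee (idem_le_trans le_ef le_we)).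
Qed.

Lemma greenJ_Lam e f : e \in Lam -> f \in Lam -> greenJ e f -> e = f.
Proof.
move=> Le Lf /(greenJ_idem (Lam_idem Le) (Lam_idem Lf))[w def_e].
have [g [_ uniq_g]] := rc_transversal HRC (Lam_idem Le).
rewrite -(uniq_g e); first apply: uniq_g; split=> //.
  by exists w^-1; rewrite -/(uconj _ _) def_e uconjVK.
by exists 1; rewrite -/(uconj _ _) uconj1.
Qed.

Lemma munit_form r : exists u f v, f \in Lam /\ r = (u : R) * f * (v : R).
Proof.
have [[e [w [Ee ->]]] _] := rc_factor HRC r.
have [f [[Lf [u def_f]] _]] := rc_transversal HRC Ee.
exists u^-1, f, (u * w); split=> //.
rewrite -def_f -/(uconj u e) muvalM.
by rewrite mulgA -(mulgA _ (uconj u e)) uconjE munitK.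
Qed.

(** The relation gives [e u e = e u], that is [e <= u e u^-1], and a unit cannot raise [e]
    strictly. *)
Lemma fixW_left e u d : e \in E -> e * (u : R) = d * e -> u \in fixW e.
Proof.
move=> Ee eu; have eue : e * (u : R) * e = e * (u : R).
  by rewrite eu -mulgA idem_sqr.
rewrite uconj_fix; apply/eqP/idem_le_conj_eq => //.
apply: idem_le_of_mull; rewrite ?uconj_idem //.
by rewrite /uconj !mulgA eue -mulgA munit_mulgV mulg1.
Qed.

Lemma fixW_right e u d : e \in E -> (u : R) * e = e * d -> u \in fixW e.
Proof.
move=> Ee ue; have eue : e * (u : R) * e = (u : R) * e.
  by rewrite -mulgA ue mulgA idem_sqr.
have: uconj u^-1 e = e.
  apply: idem_le_conj_eq => //; apply: idem_le_of_mull; rewrite ?uconj_idem //.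
  rewrite idem_comm ?uconj_idem // /uconj invgK -!mulgA.
  by rewrite (mulgA e) eue munitK.
by move=> eq_e; rewrite uconj_fix -{1}eq_e -uconjM mulgV uconj1.
Qed.

End FactorizableMonoid.

(** * Left standard forms *)

Lemma min_lcosets_uniq (W : finGroupType) (S J : {set W}) x x' :
    coxeter_system S -> x \in min_lcosets S J -> x' \in min_lcosets S J ->
  x^-1 * x' \in <<J>> -> x = x'.
Proof.
move=> HS; rewrite !inE => /andP[_ /forall_inP min_x] /andP[_ /forall_inP min_x'] Jx.
apply: bruhat_anti; first by apply: min_x; rewrite mem_lcoset.
by apply: min_x'; rewrite mem_lcoset -groupV invgM invgK.
Qed.

Lemma min_rcosets_uniq (W : finGroupType) (S J : {set W}) y y' :
    coxeter_system S -> y \in min_rcosets S J -> y' \in min_rcosets S J ->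
  y * y'^-1 \in <<J>> -> y = y'.
Proof.
move=> HS; rewrite !(min_rcosets_inv HS) => min_y min_y' Jy.
by apply/invg_inj/(min_lcosets_uniq HS min_y min_y'); rewrite invgK.
Qed.

(** * Parabolic subgroups attached to an idempotent, and its standard forms *)

Section FixedIdempotent.
Variables (R : finMonoidType) (Lam : {set R}) (S : {set munits R}) (e : R).
Hypothesis HRC : renner_coxeter Lam S.
Hypothesis Le : e \in Lam.
Local Notation W := (munits R).
Local Notation HS := (rc_coxeter HRC).
Local Notation w0 := (longest S).
Local Notation wl := (longest_in S).
Local Notation J := (lam S e).
Local Notation A := (lam_low S e).
Local Notation B := (lam_up S e).
Implicit Types (r t : R) (a b c u v w x y z : W).

Lemma lamP : J \subset S /\ <<J>> = fixW e.
Proof.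
have [[I sIS defI] _] := rc_parabolic HRC Le.
by rewrite /lam -defI (parabolic_typeE HS).
Qed.

Lemma lam_lowP : A \subset S /\ <<A>> = stabW e.
Proof.
have [_ [I sIS defI]] := rc_parabolic HRC Le.
by rewrite /lam_low -defI (parabolic_typeE HS).
Qed.

Lemma lam_sub : J \subset S. Proof. by case: lamP. Qed.
Lemma lam_low_sub : A \subset S. Proof. by case: lam_lowP. Qed.

Lemma lam_comm c : c \in <<J>> -> (c : R) * e = e * (c : R).
Proof. by have [_ ->] := lamP; rewrite inE => /eqP. Qed.

Lemma lam_low_fix c : c \in <<A>> -> (c : R) * e = e.
Proof. by have [_ ->] := lam_lowP; rewrite inE => /andP[/eqP-> /eqP]. Qed.

Lemma lam_low_lam : A \subset J.
Proof.
apply/subsetP=> s As; have Ss := subsetP lam_low_sub s As.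
apply: (parabolic_gens HS lam_sub Ss); have [_ ->] := lamP.
have: s \in <<A>> by apply: mem_gen.
by have [_ ->] := lam_lowP; rewrite !inE => /andP[].
Qed.

Lemma lam_up_low : B = J :\: A.
Proof.
rewrite -(parabolic_setI HS lam_sub) -(parabolic_setI HS lam_low_sub).
have [_ ->] := lamP; have [_ ->] := lam_lowP.
apply/setP=> s; rewrite !inE; case: (s \in S) => //=.
by case: (_ == e * _); case: (_ == e).
Qed.

Lemma lam_up_sub : B \subset S.
Proof. by rewrite lam_up_low (subset_trans (subsetDl _ _)) // lam_sub. Qed.

Lemma lam_up_lam : B \subset J.
Proof. by rewrite lam_up_low subsetDl. Qed.

Lemma lam_disjoint : [disjoint B & A].
Proof.
by rewrite lam_up_low disjoint_subset; apply/subsetP=> s; rewrite !inE => /andP[].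
Qed.

Lemma mem_lam_low c : (c : R) * e = e -> c \in <<A>>.
Proof.
move=> ce; have Ee := Lam_idem HRC Le; have [_ ->] := lam_lowP.
have: c \in fixW e by apply: (fixW_right HRC Ee (d := e)); rewrite ce idem_sqr.
by rewrite !inE ce => /eqP <-; rewrite eqxx.
Qed.

Lemma lam_low_normal u c : u \in <<J>> -> c \in <<A>> -> c ^ u \in <<A>>.
Proof.
move=> Ju Ac; apply: mem_lam_low; rewrite conjgE !muvalM -!mulgA lam_comm //.
by rewrite (mulgA (c : R)) lam_low_fix // -lam_comm // munitK.
Qed.

(** By normality [t s = a t] with [a] in [<<A>>], and comparing lengths shows that [a] is a
    generator. It is a left descent of [t s], so it is [s] or [t]; but [t] is not in [A]. *)
Lemma lam_gens_comm (s t : W) : s \in A -> t \in B -> s * t = t * s.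
Proof.
move=> As Bt; have Ss := subsetP lam_low_sub s As.
have St := subsetP lam_up_sub t Bt; have At : t \notin A.
  by rewrite (disjointFr lam_disjoint).
have min_t : min_right S A t.
  by apply: (parabolic_disjoint_min HS lam_up_sub) (mem_gen Bt);
    rewrite ?lam_low_sub ?lam_disjoint.
pose a : W := s ^ t^-1.
have Aa : a \in <<A>>.
  by apply: lam_low_normal; rewrite ?groupV ?mem_gen ?(subsetP lam_up_lam).
have def_ts : t * s = a * t by rewrite /a conjgE invgK mulgA mulgKV.
have len_a : cox_len S a = 1%N.
  have: cox_len S (a * t) = (1 + cox_len S a)%N.
    rewrite -(lenV HS) invgM (cox_inv HS St) min_t ?groupV //.
    by rewrite (lenV HS) (len_gen HS St).
  by rewrite -def_ts min_t ?mem_gen // (len_gen HS St) (len_gen HS Ss) => /addnI.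
have Sa := len_eq1 HS len_a; have {}Aa := parabolic_gens HS lam_low_sub Sa Aa.
have sts : [set s; t] \subset S by rewrite subUset !sub1set Ss.
have : a \in [set s; t].
  apply: (parabolic_left_descent HS (c := t * s)) => //.
    by rewrite groupM ?mem_gen // !inE eqxx ?orbT.
  rewrite {1}def_ts (cox_mulKg HS Sa) min_t ?mem_gen //.
  by rewrite (len_gen HS St) (len_gen HS Ss).
rewrite !inE => /orP[/eqP def_a | /eqP def_a]; first by rewrite def_ts def_a.
by rewrite -def_a Aa in At.
Qed.

Lemma lam_up_cent : <<B>> \subset 'C(<<A>>).
Proof.
rewrite cent_gen gen_subG; apply/subsetP=> t Bt; apply/centP=> s As.
by rewrite /commute (lam_gens_comm As Bt).
Qed.

Lemma lam_up_low_comm z c : z \in <<B>> -> c \in <<A>> -> z * c = c * z.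
Proof. by move=> /(subsetP lam_up_cent)/centP com_z /com_z. Qed.

Lemma lam_decomp : <<J>> = <<B>> * <<A>>.
Proof.
rewrite -(cent_joinEl lam_up_cent) joing_idl joing_idr lam_up_low; congr <<_>>.
apply/setP=> s; rewrite !inE; case As: (s \in A) => /=; last by rewrite orbF.
by rewrite (subsetP lam_low_lam).
Qed.

Lemma longest_lam_up : wl J * wl A \in <<B>>.
Proof.
apply: (longest_in_prod HS lam_sub lam_up_sub lam_low_sub lam_disjoint).
exact: lam_decomp.
Qed.

Lemma left_stdP r x y : left_std Lam S r x e y <->
  [/\ x \in min_lcosets S A, y \in min_rcosets S J & r = (x : R) * e * (y : R)].
Proof. by split=> [[_ ? ? ?] | [? ? ?]]; split. Qed.

(** The [W_J] part of [v] slides through [e] to the left, after which [e] absorbs the [W_A] part of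
    the left factor. *)
Lemma left_std_exists u v :
  exists x y, left_std Lam S ((u : R) * e * (v : R)) x e y.
Proof.
have [m [c [min_m Jc def_v]]] := min_right_coset HS v^-1 lam_sub.
have [x [d [min_x Ad def_x]]] := min_right_coset HS (u * c^-1) lam_low_sub.
exists x, m^-1; apply/left_stdP; split.
- by apply/(min_lcosetsP HS _ lam_low_sub).
- by rewrite (min_rcosets_inv HS) invgK; apply/(min_lcosetsP HS _ lam_sub).
have -> : v = c^-1 * m^-1 by rewrite -invgM -def_v invgK.
rewrite muvalM mulgA -(mulgA (u : R)) -lam_comm ?groupV // mulgA -muvalM def_x.
by rewrite muvalM -(mulgA (x : R)) (lam_low_fix Ad).
Qed.

(** The equation becomes a one-sided relation between [e] and [y * y'^-1], which therefore lies in
    [W_J]. The multiplier [g] is any element of the monoid, as in Green's relations. *)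
Lemma left_std_eqL x y x' y' (g : R) :
    y \in min_rcosets S J -> y' \in min_rcosets S J ->
  (x : R) * e * (y : R) = g * ((x' : R) * e * (y' : R)) -> y = y'.
Proof.
move=> min_y min_y' eq_xy; apply: (min_rcosets_uniq HS min_y min_y').
have [_ ->] := lamP.
apply: (fixW_left HRC (Lam_idem HRC Le) (d := ((x^-1 : W) : R) * g * (x' : R))).
rewrite muvalM mulgA; apply: (@munitI _ x); apply: (@munitIr _ y').
by rewrite -!mulgA munitKV munit_mulVg mulg1 !mulgA eq_xy !mulgA.
Qed.

Lemma left_std_eqR x y x' y' (g : R) :
  (x' : R) * e * (y' : R) = (x : R) * e * (y : R) * g -> x^-1 * x' \in <<J>>.
Proof.
move=> eq_xy; have [_ ->] := lamP.
apply: (fixW_right HRC (Lam_idem HRC Le) (d := (y : R) * g * ((y'^-1 : W) : R))).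
rewrite muvalM; apply: (@munitI _ x); apply: (@munitIr _ y').
by rewrite -!mulgA munitKV munit_mulVg mulg1 !mulgA eq_xy.
Qed.

Lemma left_std_uniq r x y x' y' :
  left_std Lam S r x e y -> left_std Lam S r x' e y' -> x = x' /\ y = y'.
Proof.
case/left_stdP=> min_x min_y def_r /left_stdP[min_x' min_y' def_r'].
have eq_y : y = y'.
  by apply: (@left_std_eqL x y x' y' 1); rewrite // mul1g -def_r -def_r'.
split=> //; apply: (min_lcosets_uniq HS min_x min_x'); apply: mem_lam_low.
rewrite muvalM; apply: (@munitI _ x); apply: (@munitIr _ y).
by rewrite -(mulgA ((x^-1 : W) : R)) munitKV -def_r eq_y -def_r'.
Qed.

Lemma adh_plus_std r t x y x' y' :
    left_std Lam S r x e y -> left_std Lam S t x' e y' ->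
  bruhat S x x' -> bruhat S y' y -> adh_plus Lam S r t.
Proof.
move=> std_r std_t le_x le_y; exists x, e, y, x', e, y'; split=> //.
  by apply/idem_leP; rewrite idem_sqr ?(Lam_idem HRC).
exists 1; rewrite invg1 mulg1 mul1g; split=> //.
by rewrite -(mulg1 1) mem_mulg.
Qed.

End FixedIdempotent.

(** * Green classes and extremal elements *)

Lemma left_std_J (R : finMonoidType) (Lam : {set R}) S r x e y :
  left_std Lam S r x e y -> greenJ r e.
Proof. by case=> _ _ _ ->; apply: greenJ_units. Qed.

Lemma left_std_uniq_idem (R : finMonoidType) (Lam : {set R}) S r t x e y x' e' y' :
    renner_coxeter Lam S -> greenJ r t ->
  left_std Lam S r x e y -> left_std Lam S t x' e' y' -> e = e'.
Proof.
move=> HRC Jrt std std'; have [[Le _ _ _] [Le' _ _ _]] := (std, std').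
apply: (greenJ_Lam HRC Le Le').
have := left_std_J std'; rewrite greenJ_sym => Je't.
have := left_std_J std; rewrite greenJ_sym => Jer.
by rewrite (greenJ_trans Jer) // (greenJ_trans Jrt) // greenJ_sym.
Qed.

Lemma adh_plus_anti (R : finMonoidType) (Lam : {set R}) S r t :
  renner_coxeter Lam S -> adh_plus Lam S r t -> adh_plus Lam S t r -> r = t.
Proof.
(* From [y <= v^-1 y <= b] and [b <= w^-1 b <= y] both [w] and [v] are trivial. *)
move=> HRC [x [e [y [a [f [b [std_r std_t le_ef [w [w_in le_x le_y]]]]]]]]].
case=> [a' [f' [b' [x' [e' [y' [std_t' std_r' le_fe [v [v_in le_a le_b]]]]]]]]].
have HS := rc_coxeter HRC.
have ee' := left_std_uniq_idem HRC (eqxx _) std_r std_r'.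
have ff' := left_std_uniq_idem HRC (eqxx _) std_t std_t'; subst e' f'.
have eq_ef := idem_le_anti le_ef le_fe; subst f.
have [Le _ min_y def_r] := std_r; have [_ _ min_b def_t] := std_t.
have [eq_x eq_y] := left_std_uniq HRC Le std_r std_r'; subst x' y'.
have [eq_a eq_b] := left_std_uniq HRC Le std_t std_t'; subst a' b'.
have in_J u : u \in <<lam_up S e>> * <<lam_low S e>> -> u^-1 \in <<lam S e>>.
  by rewrite -(lam_decomp HRC Le) groupV.
have min_le u c : u \in <<lam S e>> -> c \in min_rcosets S (lam S e) ->
    bruhat S c (u * c).
  move=> Ju; rewrite inE => /andP[_ /forall_inP]; apply.
  by rewrite mem_rcoset mulgK.
have {}min_y := min_le _ _ (in_J _ v_in) min_y.
have {}min_b := min_le _ _ (in_J _ w_in) min_b.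
have le_yb := bruhat_trans min_y le_b; have le_by := bruhat_trans min_b le_y.
have eq_yb := bruhat_anti le_yb le_by; subst b.
have /(can_inj (mulgK y))/eqP : w^-1 * y = 1 * y.
  by rewrite mul1g; apply: bruhat_anti le_y min_b.
have /(can_inj (mulgK y))/eqP : v^-1 * y = 1 * y.
  by rewrite mul1g; apply: bruhat_anti le_b min_y.
rewrite !invg_eq1 => /eqP v1 /eqP w1; rewrite v1 w1 !mulg1 in le_a le_x.
by rewrite def_r def_t (bruhat_anti le_x le_a).
Qed.

(** Antisymmetry makes an extremum unique, so exhibiting one candidate [r0] settles when [r] is
    extremal. Maxima are treated as minima of the reversed relation. *)
Lemma is_min_eq (R : finMonoidType) (le : R -> R -> Prop) (T : {set R}) r r0 :
    (forall s t, le s t -> le t s -> s = t) ->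
    r \in T -> r0 \in T -> (forall t, t \in T -> le r0 t) ->
  is_min le T r <-> r = r0.
Proof.
move=> anti Tr Tr0 min_r0; split=> [[_ min_r] | ->]; last by split.
by apply: anti; [apply: min_r | apply: min_r0].
Qed.

Section Classes.
Variables (R : finMonoidType) (Lam : {set R}) (S : {set munits R}) (e : R).
Hypothesis HRC : renner_coxeter Lam S.
Hypothesis Le : e \in Lam.
Local Notation W := (munits R).
Local Notation HS := (rc_coxeter HRC).
Local Notation w0 := (longest S).
Local Notation wl := (longest_in S).
Local Notation J := (lam S e).
Local Notation A := (lam_low S e).
Local Notation B := (lam_up S e).
Local Notation sJS := (lam_sub HRC Le).
Local Notation sAS := (lam_low_sub HRC Le).
Local Notation sAJ := (lam_low_lam HRC Le).
Implicit Types (r t : R) (a b c u v w x y z : W).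

(* If [e_- = w0 e w0] and [sigma_0 = w0 z w_A], the element whose vanilla form is
   [sigma_- e_- sigma_0 e sigma_+] is [jelt sigma_- z sigma_+]; its left standard
   form is [x e sigma_+] with [x = sigma_- w0 z w_A]. *)
Definition jelt a z b : R := ((a * w0 * z : W) : R) * e * (b : R).

Definition jcoord a z b :=
  [/\ a \in min_lcosets S (J :^ w0), z \in <<B>> & b \in min_rcosets S J].

Lemma jcoord_max a z b : jcoord a z b -> max_right S J (a * w0).
Proof.
case=> min_a _ _; apply: (max_right_longest HS sJS).
by apply/(min_lcosetsP HS (a) (longest_conj_gens HS sJS)).
Qed.

(** [e] absorbs [wl A], and inserting this factor is what makes the left factor shortest modulo
    [A]. *)
Lemma jelt_std a z b : jcoord a z b ->
  left_std Lam S (jelt a z b) (a * w0 * z * wl A) e b.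
Proof.
move=> jc; have max_v := jcoord_max jc; have [_ Bz min_b] := jc.
have [Aw _ _] := longest_inP HS sAS; split=> //.
  apply/(min_lcosetsP HS _ sAS).
  apply: (min_right_max_low HS sAJ sJS max_v).
    exact: subsetP (genS (lam_up_lam HRC Le)) z Bz.
  exact: (parabolic_disjoint_min HS (lam_up_sub HRC Le) sAS (lam_disjoint HRC Le)).
by rewrite (muvalM (a * w0 * z)) -(mulgA _ _ e) (lam_low_fix HRC Le Aw).
Qed.

(** Uniqueness of standard forms gives [a * w0 * z = a' * w0 * z']; moving [w0] across puts [a] and
    [a'] in one coset modulo [J :^ w0], where both are shortest. *)
Lemma jelt_inj a z b a' z' b' : jcoord a z b -> jcoord a' z' b' ->
  jelt a z b = jelt a' z' b' -> [/\ a = a', z = z' & b = b'].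
Proof.
move=> jc jc' eq_r; have [min_a Bz _] := jc; have [min_a' Bz' _] := jc'.
have := jelt_std jc; rewrite eq_r => /(left_std_uniq HRC Le)/(_ (jelt_std jc')).
case=> /mulIg eq_v ->.
suffices eq_a : a = a' by move: eq_v; rewrite eq_a => /mulgI ->.
apply: (min_lcosets_uniq HS min_a min_a').
have -> : a^-1 * a' = (z * z'^-1) ^ w0.
  apply: (@conjg_inj _ w0); rewrite (longestJK HS) (longestJE HS).
  apply: (mulIg z'); rewrite mulgKV; apply: (mulgI (a * w0)).
  rewrite eq_v -{1}(longest_inv HS) !mulgA.
  by rewrite mulgKV mulgV mul1g.
by rewrite genJ memJ_conjg (subsetP (genS (lam_up_lam HRC Le))) // groupM ?groupV.
Qed.

(* [cls l r u] is the H-, L-, R- or J-class of [u]; in the coordinates [x e y]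
   of the left standard form, [l] frees the left factor and [r] the right one. *)
Definition cls (l r : bool) (u : R) : {set R} :=
  [set t | [&& greenJ t u, l || greenR t u & r || greenL t u]].

Lemma cls_J r : cls true true r = J_class r.
Proof. by apply/setP=> t; rewrite !inE andbT. Qed.

Lemma cls_L r : cls true false r = L_class r.
Proof.
by apply/setP=> t; rewrite !inE andb_idl //; apply: greenL_J.
Qed.

Lemma cls_R r : cls false true r = R_class r.
Proof.
by apply/setP=> t; rewrite !inE andbT andb_idl //; apply: greenR_J.
Qed.

Lemma cls_H r : cls false false r = H_class r.
Proof.
apply/setP=> t; rewrite !inE /greenH [X in _ && X]andbC andb_idl //.
by case/andP=> /greenL_J.
Qed.

Lemma cls_refl (l r : bool) (u : R) : u \in cls l r u.
Proof. by rewrite inE /greenJ /greenR /greenL !eqxx !orbT. Qed.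

Lemma jelt_cls (l r : bool) a z b a' z' b' : jcoord a z b -> jcoord a' z' b' ->
  (~~ l -> a' = a) -> (~~ r -> b' = b) -> jelt a' z' b' \in cls l r (jelt a z b).
Proof.
move=> [_ Bz _] [_ Bz' _] eq_a eq_b; rewrite inE; apply/and3P; split.
- rewrite (greenJ_trans (greenJ_units _ _ _)) // greenJ_sym.
  exact: greenJ_units.
- case: l eq_a => //= /(_ isT) ->; rewrite /jelt !muvalM.
  have comm u : u \in <<B>> -> (u : R) * e = e * (u : R).
    by move/(subsetP (genS (lam_up_lam HRC Le))); apply: (lam_comm HRC Le).
  rewrite -!(mulgA _ _ e) !comm //; apply/greenRP; split.
    exists ((b^-1 * z^-1 * z' * b' : W) : R).
    by rewrite !muvalM -!mulgA munitKV munitKV.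
  exists ((b'^-1 * z'^-1 * z * b : W) : R).
  by rewrite !muvalM -!mulgA munitKV munitKV.
case: r eq_b => //= /(_ isT) ->; rewrite /jelt.
move: (a' * w0 * z') (a * w0 * z) => p' p; apply/greenLP; split.
  by exists ((p' * p^-1 : W) : R); rewrite muvalM -!mulgA munitK.
by exists ((p * p'^-1 : W) : R); rewrite muvalM -!mulgA munitK.
Qed.

Lemma cls_std (l r : bool) a z b t : jcoord a z b -> t \in cls l r (jelt a z b) ->
  exists x y, [/\ left_std Lam S t x e y,
    l || ((a * w0)^-1 * x \in <<J>>) & r || (y == b)].
Proof.
move=> jc; rewrite inE => /and3P[Jt Rt Lt].
have [u [f [v [Lf def_t]]]] := munit_form HRC t.
have [x [y std_t]] := left_std_exists HRC Lf u v; rewrite -def_t in std_t.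
have ef := left_std_uniq_idem HRC Jt std_t (jelt_std jc); subst f.
exists x, y; have [_ min_x min_y {}def_t] := std_t; split=> //.
  case: l Rt => //= /greenRP[[g]]; rewrite def_t /jelt => eq_t _.
  have := left_std_eqR HRC Le eq_t; rewrite invgM -mulgA groupMl //.
  by rewrite groupV (subsetP (genS (lam_up_lam HRC Le))) //; case: jc.
case: r Lt => //= /greenLP[[g]]; rewrite def_t => eq_t _.
by apply/eqP/(left_std_eqL HRC Le min_y _ eq_t); case: jc.
Qed.

End Classes.

(** * Minima and maxima of the classes in coordinates *)

Section Extremal.
Variables (R : finMonoidType) (Lam : {set R}) (S : {set munits R}) (e : R).
Hypothesis HRC : renner_coxeter Lam S.
Hypothesis Le : e \in Lam.
Local Notation W := (munits R).
Local Notation HS := (rc_coxeter HRC).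
Local Notation w0 := (longest S).
Local Notation wl := (longest_in S).
Local Notation J := (lam S e).
Local Notation A := (lam_low S e).
Local Notation sJS := (lam_sub HRC Le).
Local Notation sAS := (lam_low_sub HRC Le).
Local Notation sAJ := (lam_low_lam HRC Le).
Local Notation jcoord := (jcoord S e).
Local Notation jelt := (jelt S e).
Implicit Types (a b z : W).

Lemma min_lcosets_longest : wl J * w0 \in min_lcosets S (J :^ w0).
Proof.
have sKS := longest_conj_gens HS sJS; apply/(min_lcosetsP HS _ sKS).
have -> : wl J * w0 = w0 * wl (J :^ w0).
  by rewrite (longest_inJ HS sJS) (longestJE HS) !mulgA (longest_sqr HS) mul1g.
by apply: (min_right_longest_in HS sKS) => c _; apply: (len_longestM HS).
Qed.

Lemma min_rcosets_longest : wl J * w0 \in min_rcosets S J.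
Proof.
rewrite (min_rcosets_inv HS) invgM (longest_inv HS) (longest_in_inv HS sJS).
apply/(min_lcosetsP HS _ sJS); apply: (min_right_longest_in HS sJS) => c _.
exact: (len_longestM HS).
Qed.

Lemma min_lcosets1 (K : {set W}) : K \subset S -> 1 \in min_lcosets S K.
Proof.
move=> sKS; apply/(min_lcosetsP HS _ sKS) => c _.
by rewrite mul1g (len1 HS).
Qed.

Lemma min_rcosets1 : 1 \in min_rcosets S J.
Proof. by rewrite (min_rcosets_inv HS) invg1 min_lcosets1 ?sJS. Qed.

Lemma cls_minP (l r : bool) a z b : jcoord a z b ->
  is_min (adh_plus Lam S) (cls l r (jelt a z b)) (jelt a z b) <->
  [/\ l -> a = wl J * w0, z = wl J * wl A & r -> b = wl J * w0].
Proof.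
move=> jc; have [min_a Bz min_b] := jc.
(* A coordinate that the class leaves free takes its extremal value; the others keep that of the
   given element. *)
pose a0 : W := if l then wl J * w0 else a; pose z0 : W := wl J * wl A.
pose b0 : W := if r then wl J * w0 else b.
have jc0 : jcoord a0 z0 b0.
  split; last 1 first.
  - by rewrite /b0; case: (r); rewrite ?min_rcosets_longest.
  - by rewrite /a0; case: (l); rewrite ?min_lcosets_longest.
  exact: (longest_lam_up HRC Le).
have cls0 : jelt a0 z0 b0 \in cls l r (jelt a z b).
  apply: (jelt_cls HRC Le jc jc0).
    by rewrite /a0; case: (l).
  by rewrite /b0; case: (r).
have low t : t \in cls l r (jelt a z b) -> adh_plus Lam S (jelt a0 z0 b0) t.
  case/(cls_std HRC Le jc)=> x [y [std_t Jx eq_y]].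
  apply: (adh_plus_std HRC Le (jelt_std HRC Le jc0) std_t).
    have -> : a0 * w0 * z0 * wl A = a0 * w0 * wl J.
      rewrite /z0 -(mulgA _ _ (wl A)) -(mulgA (wl J)).
      by rewrite (longest_in_sqr HS sAS) mulg1.
    rewrite /a0.
    case: (l) Jx => /= [_|Jx].
      (* With a free left factor the candidate is [wl J * w0 * w0 * wl J = 1], the bottom of the
         Bruhat order. *)
      rewrite -(mulgA _ w0 w0) (longest_sqr HS) mulg1 (longest_in_sqr HS sJS).
      exact: (bruhat1 HS).
    (* Otherwise it is [a * w0 * wl J], the shortest element of the coset that contains [x]. *)
    have max_v := jcoord_max HRC Le jc; have [Jw _ _] := longest_inP HS sJS.
    rewrite -[x](mulKVg (a * w0 * wl J)).
    apply: (bruhat_min_right HS sJS (min_right_longest_in HS sJS max_v)).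
    by rewrite invgM -mulgA groupM ?groupV.
  rewrite /b0; case: (r) eq_y => /= [_|/eqP->]; last exact: bruhat_refl.
  by apply: (bruhat_min_rcosets HS sJS); case: std_t.
have [to_eq of_eq] := is_min_eq (fun s t => @adh_plus_anti R Lam S s t HRC)
  (cls_refl l r (jelt a z b)) cls0 low.
split=> [/to_eq /(jelt_inj HRC Le jc jc0)[-> -> ->] | [eq_a eq_z eq_b]].
  by rewrite /a0 /b0; split=> //; [case: (l) | case: (r)].
apply: of_eq; rewrite eq_z /a0 /b0.
by case: (l) eq_a => [/(_ isT)->|_]; case: (r) eq_b => [/(_ isT)->|_].
Qed.

Lemma cls_maxP (l r : bool) a z b : jcoord a z b ->
  is_max (adh_plus Lam S) (cls l r (jelt a z b)) (jelt a z b) <->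
  [/\ l -> a = 1, z = 1 & r -> b = 1].
Proof.
move=> jc; have [min_a Bz min_b] := jc.
pose a0 : W := if l then 1 else a; pose b0 : W := if r then 1 else b.
have jc0 : jcoord a0 1 b0.
  split; last 1 first.
  - by rewrite /b0; case: (r); rewrite ?min_rcosets1.
  - rewrite /a0; case: (l); rewrite ?min_lcosets1 //.
    exact: (longest_conj_gens HS sJS).
  exact: group1.
have cls0 : jelt a0 1 b0 \in cls l r (jelt a z b).
  apply: (jelt_cls HRC Le jc jc0).
    by rewrite /a0; case: (l).
  by rewrite /b0; case: (r).
have high t : t \in cls l r (jelt a z b) -> adh_plus Lam S t (jelt a0 1 b0).
  case/(cls_std HRC Le jc)=> x [y [std_t Jx eq_y]].
  apply: (adh_plus_std HRC Le std_t (jelt_std HRC Le jc0)).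
    have min_x : min_right S A x.
      by apply/(min_lcosetsP HS _ sAS); case: std_t.
    (* Both cases are [bruhat_coset_max]: in the whole group below [w0 * wl A] if the left factor is
       free, otherwise in the coset of [a * w0]. *)
    rewrite mulg1 /a0; case: (l) Jx => /= [_|Jx].
      rewrite mul1g; apply: (bruhat_coset_max HS sAS (subxx S)) => //.
        exact: (longest_max HS).
      exact: (cox_mem_gen HS).
    exact: (bruhat_coset_max HS sAJ sJS (jcoord_max HRC Le jc) min_x).
  rewrite /b0; case: (r) eq_y => /= [_|/eqP->]; last exact: bruhat_refl.
  exact: (bruhat1 HS).
have [to_eq of_eq] := is_min_eq (le := fun s t => adh_plus Lam S t s)
  (fun s t st ts => @adh_plus_anti R Lam S s t HRC ts st)
  (cls_refl l r (jelt a z b)) cls0 high.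
split=> [/to_eq /(jelt_inj HRC Le jc jc0)[-> -> ->] | [eq_a eq_z eq_b]].
  by rewrite /a0 /b0; split=> //; [case: (l) | case: (r)].
apply: of_eq; rewrite eq_z /a0 /b0.
by case: (l) eq_a => [/(_ isT)->|_]; case: (r) eq_b => [/(_ isT)->|_].
Qed.
End Extremal.

(** * Vanilla forms *)

Section ConjugateIdempotent.
Variable R : finMonoidType.
Implicit Types (e f : R) (u w : munits R).

Lemma uconj_inj w : injective (@uconj R w).
Proof. exact: can_inj (uconjVK w). Qed.

Lemma fixW_conj w e : fixW (uconj w e) = fixW e :^ w^-1.
Proof.
apply/setP=> u; rewrite mem_conjgV !uconj_fix.
by rewrite -[RHS](inj_eq (@uconj_inj w)) -!uconjM -conjgC.
Qed.

Lemma uconj_mulr w e u :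
  uconj w e * (u : R) = uconj w (e * ((u ^ w : munits R) : R)).
Proof.
apply: (@munitIr _ w); rewrite uconjE -mulgA -muvalM conjgC muvalM.
by rewrite [LHS]mulgA uconjE -!mulgA.
Qed.

Lemma stabW_conj w e : stabW (uconj w e) = stabW e :^ w^-1.
Proof.
apply/setP=> u; rewrite mem_conjgV.
have stabE f v : (v \in stabW f) = (v \in fixW f) && (f * (v : R) == f).
  by rewrite !inE.
rewrite !stabE fixW_conj mem_conjgV uconj_mulr.
by rewrite (inj_eq (@uconj_inj w)).
Qed.

Lemma lam_upE (S : {set munits R}) e :
  lam_up S e = [set s in S | (s \in fixW e) && (e * (s : R) != e)].
Proof. by apply/setP=> s; rewrite !inE. Qed.

End ConjugateIdempotent.

Section Vanilla.
Variables (R : finMonoidType) (Lam : {set R}) (S : {set munits R}).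
Hypothesis HRC : renner_coxeter Lam S.
Local Notation W := (munits R).
Local Notation HS := (rc_coxeter HRC).
Local Notation w0 := (longest S).
Local Notation wl := (longest_in S).
Implicit Types (e em ep r : R) (sm sp z : W).

Lemma longest_gens : S :^ w0 = S.
Proof.
apply/eqP; rewrite eqEcard cardJg leqnn andbT.
exact: (longest_conj_gens HS).
Qed.

(** [e_-] lies in [w0 Lam w0] rather than in [Lam], so its parabolic types are obtained by
    conjugating those of [e_+]. *)
Lemma lam_conj e : e \in Lam -> lam S (uconj w0 e) = lam S e :^ w0.
Proof.
move=> Le; have [sJS defJ] := lamP HRC Le.
rewrite {1}/lam fixW_conj (longest_inv HS) -defJ -genJ.
by rewrite (parabolic_typeE HS) // (longest_conj_gens HS).
Qed.

Lemma lam_low_conj e : e \in Lam -> lam_low S (uconj w0 e) = lam_low S e :^ w0.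
Proof.
move=> Le; have [sAS defA] := lam_lowP HRC Le.
rewrite {1}/lam_low stabW_conj (longest_inv HS) -defA -genJ.
by rewrite (parabolic_typeE HS) // (longest_conj_gens HS).
Qed.

Lemma lam_up_conj e : lam_up S (uconj w0 e) = lam_up S e :^ w0.
Proof.
apply/setP=> s; rewrite mem_conjg (longest_inv HS) !lam_upE.
rewrite [in LHS]inE [in RHS]inE fixW_conj mem_conjgV.
rewrite uconj_mulr (inj_eq (@uconj_inj R w0)); congr (_ && _).
by rewrite -[in LHS]longest_gens mem_conjg (longest_inv HS).
Qed.

Lemma conj_longestP e :
  reflect (exists2 f, f \in Lam & e = uconj w0 f) (e \in conj_longest S Lam).
Proof.
rewrite /uconj (longest_inv HS); apply: (iffP imsetP) => [] [f Lf ->];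
  by exists f.
Qed.

Lemma conj_longestK : conj_longest S (conj_longest S Lam) = Lam.
Proof.
have conjK f : (w0 : R) * ((w0 : R) * f * (w0 : R)) * (w0 : R) = f.
  rewrite -!mulgA -muvalM (longest_sqr HS) mulg1 mulgA -muvalM.
  by rewrite (longest_sqr HS) mul1g.
apply/setP=> e; apply/imsetP/idP=> [[_ /imsetP[f Lf ->] ->] | Le].
  by rewrite conjK.
by exists ((w0 : R) * e * (w0 : R)); [apply: imset_f | rewrite conjK].
Qed.

Lemma vanilla_jelt r sm em s0 ep sp : vanilla Lam S r sm em s0 ep sp ->
  exists z, [/\ ep \in Lam, em = uconj w0 ep, jcoord S ep sm z sp,
    s0 = w0 * z * wl (lam_low S ep) & r = jelt S ep sm z sp].
Proof.
case=> [[Lep /conj_longestP[f Lf def_em] Jem Jep] min_sp min_sm s0_in def_r].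
(* [e_-] and [e_+] are both J-equivalent to [r], and [Lam] meets each J-class at most once. *)
have eq_f : f = ep.
  apply: (greenJ_Lam HRC Lf Lep); apply: greenJ_trans Jep.
  by apply: greenJ_trans Jem; rewrite def_em greenJ_sym greenJ_units.
subst f em; rewrite lam_conj // in min_sm.
have [sAS _] := lam_lowP HRC Lep; have [Aw _ _] := longest_inP HS sAS.
move: s0_in; rewrite lam_up_conj lam_low_conj // (min_dcoset_conj HS sAS) genJ.
case/mulsgP=> _ b2 /mulsgP[b1 _ Bb1 /set1P-> ->] Bb2 def_s0.
(* Here [s0 = b1 * (w0 * wl A) * b2]: carrying [b1] across [w0] conjugates it into [W_B], and [wl A]
   commutes with [b2]. *)
exists (b1 ^ w0 * b2).
have Bz : b1 ^ w0 * b2 \in <<lam_up S ep>>.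
  by rewrite groupM // -(longest_inv HS) -mem_conjg.
have def_s0' : s0 = w0 * (b1 ^ w0 * b2) * wl (lam_low S ep).
  by rewrite def_s0 conjgE -!mulgA (lam_up_low_comm HRC Lep Bb2 Aw) mulKVg.
split=> //; rewrite def_r def_s0' /jelt; move: (b1 ^ w0 * b2) Bz => z Bz.
have Jz : z \in <<lam S ep>> := subsetP (genS (lam_up_lam HRC Lep)) z Bz.
rewrite /uconj (longest_inv HS) !muvalM; congr (_ * _).
rewrite -!mulgA (lam_low_fix HRC Lep Aw) (mulgA (w0 : R) (w0 : R)) -muvalM.
rewrite (longest_sqr HS) mul1g (lam_comm HRC Lep Jz).
by rewrite (mulgA ep) (idem_sqr (Lam_idem HRC Lep)).
Qed.

End Vanilla.

(** The eight equivalences with the order abstracted, so that the case of sign [-] can invoke those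
    of sign [+] for the inverse element. *)
Definition extremal_criteria (R : finMonoidType) (S : {set munits R})
    (le : R -> R -> Prop) r (sm : munits R) em (s0 : munits R) ep
    (sp : munits R) : Prop :=
  let w0 := longest S in
  let sm_min := min_dcoset S (lam S ep) w0 (lam S em) in
  let s0_min := min_dcoset S (lam S em) w0 (lam S ep) in
  let sp_min := min_dcoset S (lam S ep) w0 (lam S em) in
  let s0_max := min_dcoset S (lam_low S em) w0 (lam_low S ep) in
  (is_min le (H_class r) r <-> s0 = s0_min) /\
  (is_min le (L_class r) r <-> sm = sm_min /\ s0 = s0_min) /\
  (is_min le (R_class r) r <-> s0 = s0_min /\ sp = sp_min) /\
  (is_min le (J_class r) r <-> [/\ sm = sm_min, s0 = s0_min & sp = sp_min]) /\
  (is_max le (H_class r) r <-> s0 = s0_max) /\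
  (is_max le (L_class r) r <-> sm = 1 /\ s0 = s0_max) /\
  (is_max le (R_class r) r <-> s0 = s0_max /\ sp = 1) /\
  (is_max le (J_class r) r <-> [/\ sm = 1, s0 = s0_max & sp = 1]).

Lemma adh_plus_criteria (R : finMonoidType) (Lam : {set R}) S r sm em s0 ep sp :
  renner_coxeter Lam S -> vanilla Lam S r sm em s0 ep sp ->
  extremal_criteria S (adh_plus Lam S) r sm em s0 ep sp.
Proof.
move=> HRC /(vanilla_jelt HRC)[z [Lep -> jc -> ->]].
have HS := rc_coxeter HRC; have sJS := lam_sub HRC Lep.
have sAS := lam_low_sub HRC Lep; have wA2 := longest_in_sqr HS sAS.
rewrite /extremal_criteria /= -cls_J -cls_L -cls_R -cls_H.
rewrite (lam_conj HRC Lep) (lam_low_conj HRC Lep).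
rewrite (min_dcoset_conj HS sJS) (min_dcoset_conj HS sAS) (min_dcoset_conjV HS sJS).
set wJ := longest_in S (lam S ep); set wA := longest_in S (lam_low S ep).
(* Translates a condition on [sigma_0] into one on [z]; [c] is [wJ] for minima and [wA] for
   maxima. *)
have eq_z (c : munits R) : longest S * z * wA = longest S * c <-> z = c * wA.
  by rewrite -mulgA; split=> [/mulgI <- | ->]; rewrite -mulgA wA2 mulg1.
have min_c l f := cls_minP HRC Lep l f jc; have max_c l f := cls_maxP HRC Lep l f jc.
rewrite -/wJ -/wA in min_c max_c.
have eq_max : longest S * z * wA = longest S * wA <-> z = 1 by rewrite eq_z wA2.
have {eq_z} eq_min := eq_z wJ.
(* Evaluates the guarded conditions for the four choices of flags and puts the equation on [sigma_0]
   in place of that on [z]. *)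
have guard (l f : bool) P Q Q' T : (Q' <-> Q) ->
    [/\ l -> P, Q & f -> T] <->
    if l then if f then [/\ P, Q' & T] else P /\ Q' else if f then Q' /\ T else Q'.
  move=> [Q'Q QQ']; case: l; case: f; split.
  - by case=> /(_ isT) ? /QQ' ? /(_ isT).
  - by case=> ? /Q'Q.
  - by case=> /(_ isT) ? /QQ'.
  - by case=> ? /Q'Q.
  - by case=> _ /QQ' ? /(_ isT).
  - by case=> /Q'Q.
  - by case=> _ /QQ'.
  by move/Q'Q.
split; first exact: iff_trans (min_c false false) (guard _ _ _ _ _ _ eq_min).
split; first exact: iff_trans (min_c true false) (guard _ _ _ _ _ _ eq_min).
split; first exact: iff_trans (min_c false true) (guard _ _ _ _ _ _ eq_min).
split; first exact: iff_trans (min_c true true) (guard _ _ _ _ _ _ eq_min).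
split; first exact: iff_trans (max_c false false) (guard _ _ _ _ _ _ eq_max).
split; first exact: iff_trans (max_c true false) (guard _ _ _ _ _ _ eq_max).
split; first exact: iff_trans (max_c false true) (guard _ _ _ _ _ _ eq_max).
exact: iff_trans (max_c true true) (guard _ _ _ _ _ _ eq_max).
Qed.

(** * Reduction of the order [<=^-] to [<=^+] *)

Section Inverse.
Variables (R : finMonoidType) (Lam : {set R}) (S : {set munits R}).
Hypothesis HRC : renner_coxeter Lam S.
Local Notation W := (munits R).
Local Notation E := (@idempotents R).
Local Notation HS := (rc_coxeter HRC).
Implicit Types (e f r s t : R) (u v w x y : W).

(* The inverse of [r] in the inverse monoid [R]; the default value is never used. *)
Definition geninv r : R :=
  odflt r [pick s | (r * s * r == r) && (s * r * s == s)].

Lemma geninvP r : r * geninv r * r = r /\ geninv r * r * geninv r = geninv r.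
Proof.
rewrite /geninv; case: pickP => [s /andP[/eqP ? /eqP ?] // | no_inv].
have [[e [w [Ee def_r]]] _] := rc_factor HRC r; have ee := idem_sqr Ee.
have /negbT/negP[] := no_inv (((w^-1 : W) : R) * e); rewrite def_r; apply/andP; split.
  by rewrite -!mulgA munitKV (mulgA e e) ee (mulgA e e) ee.
by rewrite -!mulgA munitKV !ee.
Qed.

(** Inserting one inverse into the other and commuting the idempotents [r s], [r t], respectively
    [s r], [t r], brings both [t] and [s] to the form [t * r * s]. *)
Lemma geninv_unique r s : r * s * r = r -> s * r * s = s -> geninv r = s.
Proof.
move=> rsr srs; have [] := geninvP r; set t := geninv r => rtr trt.
have Esr : s * r \in E by rewrite inE mulgA srs.
have Ers : r * s \in E by rewrite inE mulgA rsr.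
have Etr : t * r \in E by rewrite inE mulgA trt.
have Ert : r * t \in E by rewrite inE mulgA rtr.
have eq_t : t = t * ((r * s) * (r * t)).
  have -> : t * ((r * s) * (r * t)) = t * (r * s * r) * t by rewrite !mulgA.
  by rewrite rsr trt.
have eq_s : s = (s * r) * (t * r) * s.
  have -> : (s * r) * (t * r) * s = s * (r * t * r) * s by rewrite !mulgA.
  by rewrite rtr srs.
rewrite eq_t (idem_comm HRC Ers Ert) {2}eq_s (idem_comm HRC Esr Etr).
have -> : t * ((r * t) * (r * s)) = (t * r * t) * (r * s) by rewrite !mulgA.
have -> : (t * r) * (s * r) * s = (t * r) * (s * r * s) by rewrite !mulgA.
by rewrite trt srs mulgA.
Qed.

Lemma geninvK : involutive geninv.
Proof. by move=> r; have [? ?] := geninvP r; apply: geninv_unique. Qed.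

Lemma geninvM r s : geninv (r * s) = geninv s * geninv r.
Proof.
have [rr' r'r] := geninvP r; have [ss' s's] := geninvP s.
set r' := geninv r in rr' r'r *; set s' := geninv s in ss' s's *.
have Er : r' * r \in E by rewrite inE mulgA r'r.
have Es : s * s' \in E by rewrite inE mulgA ss'.
apply: geninv_unique.
  have -> : r * s * (s' * r') * (r * s) = r * ((s * s') * (r' * r)) * s.
    by rewrite !mulgA.
  by rewrite (idem_comm HRC Es Er) !mulgA rr' -!mulgA (mulgA s) ss'.
have -> : s' * r' * (r * s) * (s' * r') = s' * ((r' * r) * (s * s')) * r'.
  by rewrite !mulgA.
by rewrite (idem_comm HRC Er Es) !mulgA s's -!mulgA (mulgA r') r'r.
Qed.

Lemma geninv_idem e : e \in E -> geninv e = e.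
Proof. by move/idem_sqr=> ee; apply: geninv_unique; rewrite !ee. Qed.

Lemma geninv_unit u : geninv u = (u^-1 : W).
Proof.
by apply: geninv_unique; rewrite ?munit_mulgV ?munit_mulVg mul1g.
Qed.

Lemma geninv_form u e v : e \in E ->
  geninv ((u : R) * e * (v : R)) = ((v^-1 : W) : R) * e * ((u^-1 : W) : R).
Proof. by move=> Ee; rewrite !geninvM !geninv_unit geninv_idem // mulgA. Qed.

Lemma greenL_geninv r s : greenL (geninv r) (geninv s) = greenR r s.
Proof.
apply/greenLP/greenRP=> [] [[a def_r] [b def_s]].
  split; first by exists (geninv a); rewrite -[r]geninvK def_r geninvM geninvK.
  by exists (geninv b); rewrite -[s]geninvK def_s geninvM geninvK.
by split; [exists (geninv a); rewrite {1}def_r | exists (geninv b); rewrite {1}def_s];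
  rewrite geninvM.
Qed.

Lemma greenR_geninv r s : greenR (geninv r) (geninv s) = greenL r s.
Proof. by rewrite -greenL_geninv !geninvK. Qed.

Lemma greenJ_geninv r s : greenJ (geninv r) (geninv s) = greenJ r s.
Proof.
suffices imp (t t' : R) : greenJ t t' -> greenJ (geninv t) (geninv t').
  by apply/idP/idP=> [/imp|]; [rewrite !geninvK | apply: imp].
case/greenJP=> [[a [b def_t]] [c [d def_t']]]; apply/greenJP; split.
  by exists (geninv b), (geninv a); rewrite {1}def_t !geninvM mulgA.
by exists (geninv d), (geninv c); rewrite {1}def_t' !geninvM mulgA.
Qed.

Lemma right_std_geninv r y e x :
  right_std Lam S r y e x <-> left_std Lam S (geninv r) x^-1 e y^-1.
Proof.
split=> [[Le min_y min_x ->] | [Le min_x min_y def_r]].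
  split; first exact: Le.
  - by move: min_x; rewrite (min_rcosets_inv HS).
  - by rewrite (min_rcosets_inv HS) invgK.
  by rewrite geninv_form // (Lam_idem HRC).
split; first exact: Le.
- by move: min_y; rewrite (min_rcosets_inv HS) invgK.
- by rewrite (min_rcosets_inv HS).
by rewrite -[r]geninvK def_r geninv_form ?(Lam_idem HRC) // !invgK.
Qed.

(** The witness becomes [w^-1]: inversion swaps the two parabolic factors containing [w] and
    preserves the Bruhat order. *)
Lemma adh_minus_geninv r s :
  adh_minus Lam S r s <-> adh_plus Lam S (geninv r) (geninv s).
Proof.
have mem_inv (X Y : {set W}) w : w \in <<X>> * <<Y>> -> w^-1 \in <<Y>> * <<X>>.
  by case/mulsgP=> x y Xx Yy ->; rewrite invgM mem_mulg ?groupV.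
split.
  case=> y [e [x [b [f [a [std_r std_s le_ef [w [w_in le_x le_y]]]]]]]].
  exists x^-1, e, y^-1, a^-1, f, b^-1; split.
  - exact/right_std_geninv.
  - exact/right_std_geninv.
  - exact: le_ef.
  exists w^-1; split; first exact: mem_inv.
    by rewrite -invgM (bruhatV HS).
  by rewrite -invgM (bruhatV HS).
case=> x [e [y [a [f [b [std_r std_s le_ef [w [w_in le_x le_y]]]]]]]].
exists y^-1, e, x^-1, b^-1, f, a^-1; split.
- by apply/right_std_geninv; rewrite 2!invgK.
- by apply/right_std_geninv; rewrite 2!invgK.
- exact: le_ef.
exists w^-1; split; first exact: mem_inv.
  by rewrite -invgM (bruhatV HS).
by rewrite -invgM (bruhatV HS).
Qed.

Lemma is_min_geninv (le le' : R -> R -> Prop) (T T' : {set R}) r :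
    (forall s t, le s t <-> le' (geninv s) (geninv t)) ->
    (forall t, (t \in T) = (geninv t \in T')) ->
  is_min le T r <-> is_min le' T' (geninv r).
Proof.
move=> le_inv T_inv; rewrite /is_min T_inv.
split=> [] [-> min_r]; split=> // t Tt; last by apply/le_inv/min_r; rewrite -T_inv.
by rewrite -[t]geninvK; apply/le_inv/min_r; rewrite T_inv geninvK.
Qed.

Lemma min_dcoset_eqV I K u :
  u^-1 = min_dcoset S I (longest S) K <-> u = min_dcoset S K (longest S) I.
Proof.
rewrite -(min_dcosetV HS I K).
by split=> [<- | ->]; rewrite invgK.
Qed.

(** Explains the choice of [Lam^-] for the sign [-]: inversion exchanges [e_-] and [e_+], and the
    [e_-] of a form over [w0 Lam w0] lies in [Lam]. *)
Lemma vanilla_geninv r (sm s0 sp : W) em ep :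
    vanilla (conj_longest S Lam) S r sm em s0 ep sp ->
  vanilla Lam S (geninv r) sp^-1 ep s0^-1 em sm^-1.
Proof.
case=> [[Lep Lem Jem Jep] min_sp min_sm s0_in def_r].
rewrite (conj_longestK HRC) in Lem; have Eem := Lam_idem HRC Lem.
have Eep : ep \in E.
  by have [f /(Lam_idem HRC) Ef ->] := conj_longestP HRC _ Lep; apply: uconj_idem.
split.
- split=> //.
    by rewrite -(geninv_idem Eep) greenJ_geninv greenJ_sym.
  by rewrite -(geninv_idem Eem) greenJ_geninv greenJ_sym.
- by rewrite (min_rcosets_inv HS) invgK.
- by rewrite -(min_rcosets_inv HS).
- case/mulsgP: s0_in => _ b2 /mulsgP[b1 _ Bb1 /set1P-> ->] Bb2 ->.
  rewrite !invgM (min_dcosetV HS) mulgA.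
  by rewrite !mem_mulg ?groupV ?set11.
rewrite def_r !geninvM !geninv_unit (geninv_idem Eem) (geninv_idem Eep).
by rewrite !mulgA.
Qed.

(** These are the criteria for [geninv r] with the L- and R-clauses exchanged; inverting the
    equations swaps the two sides of each double coset of [w0]. *)
Lemma adh_minus_criteria r (sm s0 sp : W) em ep :
    vanilla (conj_longest S Lam) S r sm em s0 ep sp ->
  extremal_criteria S (adh_minus Lam S) r sm em s0 ep sp.
Proof.
move=> /vanilla_geninv/(adh_plus_criteria HRC).
have leV s t : adh_minus Lam S t s <-> adh_plus Lam S (geninv t) (geninv s).
  exact: adh_minus_geninv.
have HV t : (t \in H_class r) = (geninv t \in H_class (geninv r)).
  by rewrite !inE /greenH greenL_geninv greenR_geninv andbC.
have LV t : (t \in L_class r) = (geninv t \in R_class (geninv r)).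
  by rewrite !inE greenR_geninv.
have RV t : (t \in R_class r) = (geninv t \in L_class (geninv r)).
  by rewrite !inE greenL_geninv.
have JV t : (t \in J_class r) = (geninv t \in J_class (geninv r)).
  by rewrite !inE greenJ_geninv.
have minV (T T' : {set R}) := @is_min_geninv _ _ T T' r adh_minus_geninv.
have maxV (T T' : {set R}) : (forall t, (t \in T) = (geninv t \in T')) ->
    is_max (adh_minus Lam S) T r <-> is_max (adh_plus Lam S) T' (geninv r).
  exact: (@is_min_geninv (fun s t => adh_minus Lam S t s)
    (fun s t => adh_plus Lam S t s) T T' r leV).
have := (minV _ _ HV, minV _ _ LV, minV _ _ RV, minV _ _ JV).
have := (maxV _ _ HV, maxV _ _ LV, maxV _ _ RV, maxV _ _ JV).
move=> [[[maxH maxL] maxR] maxJ] [[[minH minL] minR] minJ].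
have inv1 u : u^-1 = 1 <-> u = 1.
  by split=> [/eqP | ->]; rewrite ?invg1 // invg_eq1 => /eqP.
have s0_min := min_dcoset_eqV (lam S ep) (lam S em) s0.
have s0_max := min_dcoset_eqV (lam_low S ep) (lam_low S em) s0.
have s_min := min_dcoset_eqV (lam S em) (lam S ep).
have swap2 P Q P' Q' : (P <-> P') -> (Q <-> Q') -> P /\ Q <-> Q' /\ P'.
  by move=> [P1 P2] [Q1 Q2]; split=> [[/P1 ? /Q1] | [/Q2 ? /P2]].
have swap3 P Q T P' Q' T' : (P <-> P') -> (Q <-> Q') -> (T <-> T') ->
    [/\ P, Q & T] <-> [/\ T', Q' & P'].
  by move=> [P1 P2] [Q1 Q2] [T1 T2]; split=> [[/P1 ? /Q1 ? /T1] | [/T2 ? /Q2 ? /P2]].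
case=> cH [cL [cR [cJ [dH [dL [dR dJ]]]]]].
split; first exact: iff_trans minH (iff_trans cH s0_min).
split; first exact: iff_trans minL (iff_trans cR (swap2 _ _ _ _ s0_min (s_min sm))).
split; first exact: iff_trans minR (iff_trans cL (swap2 _ _ _ _ (s_min sp) s0_min)).
split.
  apply: iff_trans minJ (iff_trans cJ _).
  exact: swap3 (s_min sp) s0_min (s_min sm).
split; first exact: iff_trans maxH (iff_trans dH s0_max).
split; first exact: iff_trans maxL (iff_trans dR (swap2 _ _ _ _ s0_max (inv1 sm))).
split; first exact: iff_trans maxR (iff_trans dL (swap2 _ _ _ _ (inv1 sp) s0_max)).
apply: iff_trans maxJ (iff_trans dJ _).
exact: swap3 (inv1 sp) s0_max (inv1 sm).
Qed.

End Inverse.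

Theorem theorem5p3 (R : finMonoidType) (Lam : {set R}) (S : {set munits R})
    (HRC : renner_coxeter Lam S) (eps : bool)
    (r : R) (sm : munits R) (em : R) (s0 : munits R) (ep : R) (sp : munits R)
    (Hr : vanilla (Lam_sign eps Lam S) S r sm em s0 ep sp) :
  let w0 := longest S in
  let le := adherence eps Lam S in
  let sm_min := min_dcoset S (lam S ep) w0 (lam S em) in
  let s0_min := min_dcoset S (lam S em) w0 (lam S ep) in
  let sp_min := min_dcoset S (lam S ep) w0 (lam S em) in
  let s0_max := min_dcoset S (lam_low S em) w0 (lam_low S ep) in
  (is_min le (H_class r) r <-> s0 = s0_min) /\
  (is_min le (L_class r) r <-> sm = sm_min /\ s0 = s0_min) /\
  (is_min le (R_class r) r <-> s0 = s0_min /\ sp = sp_min) /\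
  (is_min le (J_class r) r <-> [/\ sm = sm_min, s0 = s0_min & sp = sp_min]) /\
  (is_max le (H_class r) r <-> s0 = s0_max) /\
  (is_max le (L_class r) r <-> sm = 1 /\ s0 = s0_max) /\
  (is_max le (R_class r) r <-> s0 = s0_max /\ sp = 1) /\
  (is_max le (J_class r) r <-> [/\ sm = 1, s0 = s0_max & sp = 1]).
Proof.
case: eps Hr => Hr; first exact: (adh_plus_criteria HRC Hr).
exact: (adh_minus_criteria HRC Hr).
Qed.
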